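(* Define $\rho(\gamma_1,\gamma_2)\in\mathbb{Q}$ for $\gamma_1,\gamma_2\in M_2^+(\mathbb{Z})$, $\gamma_2=\begin{pmatrix}a_2&b_2\\c_2&d_2\end{pmatrix}$, by the following formulae. If $c_2=0$, $$\rho(\gamma_1,\gamma_2)=\frac{b_2}{d_2}\left(\sum_{y\cdot\check\gamma_1=0}\mathbf{B}_2(y_1)-\frac16\right).$$ If $c_2>0$, $$\rho(\gamma_1,\gamma_2)=\frac{a_2}{c_2}\left(\sum_{y\cdot\check\gamma_1=0}\mathbf{B}_2(y_1)-\frac16\right)+\frac{d_2}{c_2}\left(\sum_{z\cdot\check\gamma_2\check\gamma_1=0}\mathbf{B}_2(z_1)-\sum_{y\cdot\check\gamma_2=0}\mathbf{B}_2(y_1)\right)$$ $$-2\sum_{y\cdot\check\gamma_1=0}\ \sum_{j=0}^{c_2'-1}\mathbf{B}_1\left(\frac{y_1+j}{c_2'}\right)\mathbf{B}_1\left(\frac{a_2'(y_1+j)}{c_2'}+y_2\right)+2\sum_{j=0}^{c_2'-1}\mathbf{B}_1\left(\frac{j}{c_2'}\right)\mathbf{B}_1\left(\frac{a_2'j}{c_2'}\right),$$ where $\frac{a_2'}{c_2'}$ is the fraction $\frac{a_2}{c_2}$ in lowest terms (with $c_2'>0$). Then $\rho$ gives a $2$-cocycle $\rho\in Z^2(\mathrm{PSL}(2,\mathbb{Q}),\mathbb{Q})$, and this cocycle represents the Euler class $e\in H^2(\mathrm{PSL}(2,\mathbb{Q}),\mathbb{Q})$.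
   Context: $M_2^+(\mathbb{Z})$ is the set of integral $2\times2$ matrices of positive determinant. One identifies $\mathrm{PGL}^+(2,\mathbb{Q})\cong M_2^+(\mathbb{Z})/\{\text{scalars}\}$ and regards $\mathrm{PSL}(2,\mathbb{Q})$ as a subgroup; $\rho$ on $\mathrm{PSL}(2,\mathbb{Q})$ is evaluated by choosing integral representatives in $M_2^+(\mathbb{Z})$, the representative of the second argument being chosen with lower left entry $c_2\ge0$ (the value being independent of these choices). For $\gamma\in M_2^+(\mathbb{Z})$, $\check\gamma=\det(\gamma)\,\gamma^{-1}$. The sums are over row vectors $y=(y_1,y_2)$ (resp. $z=(z_1,z_2)$) in $(\mathbb{Q}/\mathbb{Z})^2$ satisfying the indicated equation in $(\mathbb{Q}/\mathbb{Z})^2$; these are finite sums. In the double sum, $y_1$ and $y_2$ denote representatives in $\mathbb{Q}$ of the corresponding classes (the inner sum does not depend on them). $\mathbf{B}_2:\mathbb{Q}/\mathbb{Z}\to\mathbb{Q}$ is the periodized Bernoulli function $\mathbf{B}_2(x)=B_2(x-[x])$ with $B_2(X)=X^2-X+\frac16$ and $[x]$ the integer part. $\mathbf{B}_1:\mathbb{Q}/\mathbb{Z}\to\mathbb{Q}$ is the periodized function of $B_1(X)=X-\frac12$, with the usual (sawtooth) convention: $\mathbf{B}_1(x)=x-[x]-\frac12$ if $x\notin\mathbb{Z}$ and $\mathbf{B}_1(x)=0$ if $x\in\mathbb{Z}$. Group cohomology is computed with inhomogeneous cochains with trivial coefficients ($\mathrm{PSL}(2,\mathbb{Q})$ as a discrete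 group), with $(\partial f)(\gamma_1,\gamma_2)=f(\gamma_2)-f(\gamma_1\gamma_2)+f(\gamma_1)$. The Euler class $e$ is the image in rational cohomology of the restriction to $\mathrm{PSL}(2,\mathbb{Q})$ of the Euler class of $\mathrm{PSL}(2,\mathbb{R})$ (as a discrete group) attached to its action on the circle $\mathbb{P}^1(\mathbb{R})$, i.e. of the class of the central extension of $\mathrm{PSL}(2,\mathbb{R})$ by $\mathbb{Z}$ given by the universal cover, with sign normalized so that on the uniformizing representation of a closed oriented hyperbolic surface $\Gamma\backslash H$ of genus $g\ge2$ (orientation induced from the upper half-plane $H$) it evaluates to $2-2g$. *)

(* Defs.v *)
From HB Require Import structures.
From mathcomp Require Import all_boot all_order all_algebra archimedean.
From mathcomp Require Import generic_quotient.
From mathcomp Require Import all_classical all_reals all_analysis.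
From mathcomp Require Import complex.

Set Implicit Arguments.
Unset Strict Implicit.
Unset Printing Implicit Defensive.

Import Order.TTheory GRing.Theory Num.Theory.
Import numFieldNormedType.Exports.

Local Open Scope classical_set_scope.
Local Open Scope ring_scope.
Local Open Scope quotient_scope.

Section GroupCohomology.
Variables (G : groupType) (A : zmodType).

Definition coboundary1 (u : G -> A) (g h : G) : A := u h - u (g * h)%g + u g.

Definition cocycle2 (f : G -> G -> A) : Prop :=
  forall g h k : G, f h k - f (g * h)%g k + f g (h * k)%g - f g h = 0.

Definition cohomologous (f f' : G -> G -> A) : Prop :=
  exists u : G -> A, forall g h : G, f g h - f' g h = coboundary1 u g h.

End GroupCohomology.

Section PSL2.
Variable F : fieldType.

Record SL2 := MkSL2 { mx_of_SL2 :> 'M[F]_2; det_SL2 : \det mx_of_SL2 == 1 }.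

HB.instance Definition _ := [isSub for mx_of_SL2].
HB.instance Definition _ := [Choice of SL2 by <:].

Fact SL2_one_subproof : \det (1%:M : 'M[F]_2) == 1.
Proof. by rewrite det1. Qed.

Fact SL2_mul_subproof (A B : SL2) : \det (A *m B) == 1.
Proof. by rewrite det_mulmx (eqP (det_SL2 A)) (eqP (det_SL2 B)) mulr1. Qed.

Fact SL2_inv_subproof (A : SL2) : \det (invmx A) == 1.
Proof. by rewrite det_inv (eqP (det_SL2 A)) invr1. Qed.

Definition SL2_one := MkSL2 SL2_one_subproof.
Definition SL2_mul A B := MkSL2 (SL2_mul_subproof A B).
Definition SL2_inv A := MkSL2 (SL2_inv_subproof A).

Fact SL2_unit (A : SL2) : (A : 'M[F]_2) \in unitmx.
Proof. by rewrite unitmxE (eqP (det_SL2 A)) unitr1. Qed.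

Fact SL2_mulA : associative SL2_mul.
Proof. by move=> A B C; apply/val_inj; rewrite /= mulmxA. Qed.

Fact SL2_mul1 : left_id SL2_one SL2_mul.
Proof. by move=> A; apply/val_inj; rewrite /= mul1mx. Qed.

Fact SL2_1mul : right_id SL2_one SL2_mul.
Proof. by move=> A; apply/val_inj; rewrite /= mulmx1. Qed.

Fact SL2_mulV : left_inverse SL2_one SL2_inv SL2_mul.
Proof. by move=> A; apply/val_inj; rewrite /= mulVmx ?SL2_unit. Qed.

Fact SL2_Vmul : right_inverse SL2_one SL2_inv SL2_mul.
Proof. by move=> A; apply/val_inj; rewrite /= mulmxV ?SL2_unit. Qed.

HB.instance Definition _ :=
  isGroup.Build SL2 SL2_mulA SL2_mul1 SL2_1mul SL2_mulV SL2_Vmul.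

Definition eq_up_to_sign (A B : SL2) : bool :=
  (A == B) || ((A : 'M[F]_2) == - (B : 'M[F]_2)).

Fact eq_up_to_sign_refl : reflexive eq_up_to_sign.
Proof. by move=> A; rewrite /eq_up_to_sign eqxx. Qed.

Fact eq_up_to_sign_sym : symmetric eq_up_to_sign.
Proof.
move=> A B; rewrite /eq_up_to_sign eq_sym; congr (_ || _).
by rewrite -eqr_oppLR eq_sym.
Qed.

Fact eq_up_to_sign_trans : transitive eq_up_to_sign.
Proof.
move=> B A C; rewrite /eq_up_to_sign => /orP[/eqP-> //|/eqP AB].
by case/orP=> /eqP BC; rewrite -!(inj_eq val_inj) /= AB BC ?opprK eqxx ?orbT.
Qed.

Canonical eq_up_to_sign_equiv :=
  EquivRel eq_up_to_sign eq_up_to_sign_refl eq_up_to_sign_sym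
    eq_up_to_sign_trans.

Definition PSL2 := {eq_quot eq_up_to_sign}.

HB.instance Definition _ := Choice.on PSL2.
HB.instance Definition _ := EqQuotient.on PSL2.

Definition PSL2_one : PSL2 := \pi_PSL2 1%g.
Definition PSL2_mul (p q : PSL2) : PSL2 := \pi_PSL2 (repr p * repr q)%g.
Definition PSL2_inv (p : PSL2) : PSL2 := \pi_PSL2 (repr p)^-1%g.

Fact PSL2_eqP (A B : SL2) :
  reflect (A = B \/ (A : 'M[F]_2) = - (B : 'M[F]_2))
          (\pi_PSL2 A == \pi_PSL2 B).
Proof.
rewrite eqquotE; apply: (iffP orP) => -[].
- by move/eqP; left.
- by move/eqP; right.
- by move=> ->; left.
- by move=> ->; right.
Qed.

Fact PSL2_reprP (A : SL2) :
  repr (\pi_PSL2 A) = A \/ (repr (\pi_PSL2 A) : 'M[F]_2) = - (A : 'M[F]_2).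
Proof. by apply/PSL2_eqP; rewrite reprK. Qed.

Fact PSL2_mul_pi (A B : SL2) :
  PSL2_mul (\pi_PSL2 A) (\pi_PSL2 B) = \pi_PSL2 (A * B)%g.
Proof.
apply/eqP/PSL2_eqP.
case: (PSL2_reprP A) => hA; case: (PSL2_reprP B) => hB.
- by left; rewrite hA hB.
- by right; rewrite /= hA hB mulmxN.
- by right; rewrite /= hA hB mulNmx.
- by left; apply/val_inj; rewrite /= hA hB mulmxN mulNmx opprK.
Qed.

Fact PSL2_mulA : associative PSL2_mul.
Proof.
elim/quotW=> A; elim/quotW=> B; elim/quotW=> C.
by rewrite (PSL2_mul_pi B C) (PSL2_mul_pi A B) !PSL2_mul_pi mulgA.
Qed.

Fact PSL2_mul1 : left_id PSL2_one PSL2_mul.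
Proof. by elim/quotW=> A; rewrite PSL2_mul_pi mul1g. Qed.

Fact PSL2_1mul : right_id PSL2_one PSL2_mul.
Proof. by elim/quotW=> A; rewrite PSL2_mul_pi mulg1. Qed.

Fact PSL2_mulV : left_inverse PSL2_one PSL2_inv PSL2_mul.
Proof. by move=> p; rewrite -{2}[p]reprK PSL2_mul_pi mulVg. Qed.

Fact PSL2_Vmul : right_inverse PSL2_one PSL2_inv PSL2_mul.
Proof. by move=> p; rewrite -{1}[p]reprK PSL2_mul_pi mulgV. Qed.

HB.instance Definition _ :=
  isGroup.Build PSL2 PSL2_mulA PSL2_mul1 PSL2_1mul PSL2_mulV PSL2_Vmul.

End PSL2.

Section RestrictionToRationals.
Variable R : realType.

Fact SL2_ratr_subproof (A : SL2 rat) : \det (map_mx ratr A : 'M[R]_2) == 1.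
Proof. by rewrite det_map_mx (eqP (det_SL2 A)) rmorph1. Qed.

Definition SL2_ratr (A : SL2 rat) : SL2 R := MkSL2 (SL2_ratr_subproof A).

Definition PSL2_ratr (p : PSL2 rat) : PSL2 R := \pi_(PSL2 R) (SL2_ratr (repr p)).

End RestrictionToRationals.

Section Rho.

Definition periodic_B1 (x : rat) : rat :=
  if x \is a Num.int then 0 else x - (Num.floor x)%:~R - 2^-1.

Definition periodic_B2 (x : rat) : rat :=
  let t := x - (Num.floor x)%:~R in t ^+ 2 - t + 6^-1.

Definition check (M : 'M[rat]_2) : 'M[rat]_2 := \det M *: invmx M.

(* Q/Z is represented by the rationals of [0, 1), so this is the set of the   *)
(* y in (Q/Z)^2 such that y N = 0.                                            *)
Definition QZ_kernel (N : 'M[rat]_2) : set 'rV[rat]_2 :=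
  [set y : 'rV[rat]_2 | (forall i, 0 <= y 0 i < 1) /\
           (forall i, (y *m N) 0 i \is a Num.int)].

Definition sum_B2 (N : 'M[rat]_2) : rat :=
  \sum_(y \in QZ_kernel N) periodic_B2 (y 0 0).

(* Only meaningful when the lower left entry of M2 is nonnegative.            *)
Definition rho (M1 M2 : 'M[int]_2) : rat :=
  let g1 : 'M[rat]_2 := map_mx intr M1 in
  let g2 : 'M[rat]_2 := map_mx intr M2 in
  let a := g2 0 0 in let b := g2 0 1 in
  let c := g2 1 0 in let d := g2 1 1 in
  if c == 0 then (b / d) * (sum_B2 (check g1) - 6^-1)
  else
    let a' : rat := (numq (a / c))%:~R in
    let c' : nat := `|denq (a / c)|%N in
    (a / c) * (sum_B2 (check g1) - 6^-1)
    + (d / c) * (sum_B2 (check g2 *m check g1) - sum_B2 (check g2))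
    - 2 * (\sum_(y \in QZ_kernel (check g1)) \sum_(0 <= j < c')
             periodic_B1 ((y 0 0 + j%:R) / c'%:R) *
             periodic_B1 (a' * (y 0 0 + j%:R) / c'%:R + y 0 1))
    + 2 * (\sum_(0 <= j < c')
             periodic_B1 (j%:R / c'%:R) * periodic_B1 (a' * j%:R / c'%:R)).

Definition integral_representative (M : 'M[int]_2) (p : PSL2 rat) : Prop :=
  0 < \det M /\ exists t : rat, map_mx intr M = t *: (repr p : 'M[rat]_2).

End Rho.

Section EulerClass.
Variable R : realType.

Definition direction (t : R) : 'cV[R]_2 :=
  \col_(i < 2) (if i == 0 then cos t else sin t).

(* t |-> [cos t : sin t] is the universal cover R -> P^1(R), with deck group  *)
(* pi Z. The lifts to R of the action of PSL(2, R) on P^1(R) form under       *)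
(* composition the universal covering group of PSL(2, R), whose kernel onto   *)
(* PSL(2, R) is the group of translations by pi Z.                            *)
Definition circle_lift (p : PSL2 R) (f : R -> R) : Prop :=
  continuous f /\
  forall t, exists k : R, repr p *m direction t = k *: direction (f t).

(* E is the cocycle of the extension defined by the set-theoretic section s.  *)
(* Identifying the kernel with Z by translation by pi is a choice of sign.    *)
Definition universal_cover_cocycle (E : PSL2 R -> PSL2 R -> int) : Prop :=
  exists s : PSL2 R -> R -> R,
    (forall p, circle_lift p (s p)) /\
    (forall p q t, s p (s q t) = s (p * q)%g t + pi *~ E p q).

Definition upper_half_plane : set R[i] := [set z : R[i] | 0 < complex.Im z].

Definition moebius (p : PSL2 R) (z : R[i]) : R[i] :=
  let A : 'M[R]_2 := repr p in
  ((A 0 0)%:C * z + (A 0 1)%:C)%C / ((A 1 0)%:C * z + (A 1 1)%:C)%C.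

Definition subgroup (Gamma : set (PSL2 R)) : Prop :=
  Gamma 1%g /\ forall p q, Gamma p -> Gamma q -> Gamma (p * q^-1)%g.

Definition discrete (Gamma : set (PSL2 R)) : Prop :=
  exists2 eps : R, 0 < eps &
    forall A : SL2 R, Gamma (\pi_(PSL2 R) A) ->
      (forall i j, `|A i j - (i == j)%:R| < eps) -> A = 1%g.

Definition acts_freely (Gamma : set (PSL2 R)) : Prop :=
  forall p z, Gamma p -> upper_half_plane z -> moebius p z = z -> p = 1%g.

(* The boxes |x| <= M, 1/M <= y <= M are a compact exhaustion of H.           *)
Definition cocompact (Gamma : set (PSL2 R)) : Prop :=
  exists M : R, forall z, upper_half_plane z ->
    exists2 p, Gamma p &
      let w := moebius p z in
      `|complex.Re w| <= M /\ M^-1 <= complex.Im w <= M.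

(* Uniformizing groups of closed hyperbolic surfaces Gamma \ H.               *)
Definition closed_surface_group (Gamma : set (PSL2 R)) : Prop :=
  [/\ subgroup Gamma, discrete Gamma, acts_freely Gamma & cocompact Gamma].

(* The coordinates (x, x^2 + y^2) on H preserve orientation and turn the      *)
(* geodesics into straight line segments (Klein model). Hence orient z1 z2 z3 *)
(* is positive (negative) iff (z1, z2, z3) is a positively (negatively)       *)
(* oriented geodesic triangle, and zero iff the points lie on one geodesic.   *)
Definition orient (z1 z2 z3 : R[i]) : R :=
  let x z := complex.Re z in
  let n z := complex.Re z ^+ 2 + complex.Im z ^+ 2 in
  (x z2 - x z1) * (n z3 - n z1) - (x z3 - x z1) * (n z2 - n z1).

Definition closed_triangle (z1 z2 z3 : R[i]) : set R[i] :=
  [set z : R[i] | [/\ upper_half_plane z,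
               0 <= orient z1 z2 z3 * orient z z2 z3,
               0 <= orient z1 z2 z3 * orient z1 z z3 &
               0 <= orient z1 z2 z3 * orient z1 z2 z]].

Definition open_triangle (z1 z2 z3 : R[i]) : set R[i] :=
  [set z : R[i] | [/\ upper_half_plane z,
               0 < orient z1 z2 z3 * orient z z2 z3,
               0 < orient z1 z2 z3 * orient z1 z z3 &
               0 < orient z1 z2 z3 * orient z1 z2 z]].

(* The bar simplex [g | h], straightened to a geodesic simplex, has vertices  *)
(* x, g x, g h x; simplex_sign is its orientation.                            *)
Definition simplex_sign (x : R[i]) (s : PSL2 R * PSL2 R) : int :=
  sgz (orient x (moebius s.1 x) (moebius (s.1 * s.2)%g x)).

(* The translate by p of the geodesic simplex of s.                           *)
Definition on_translate (T : R[i] -> R[i] -> R[i] -> set R[i])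
    (x : R[i]) (p : PSL2 R) (s : PSL2 R * PSL2 R) : set R[i] :=
  T (moebius p x) (moebius (p * s.1)%g x) (moebius (p * s.1 * s.2)%g x).

(* The triangles of c project to a geodesic triangulation of Gamma \ H with   *)
(* the image of x as its only vertex, and the sum of the triangles oriented   *)
(* as H, that is, of the simplex_sign x s times s, is a cycle in the bar      *)
(* complex: the coefficient of each [k] in its boundary vanishes. This cycle  *)
(* represents the fundamental class of Gamma \ H.                             *)
Definition fundamental_cycle (Gamma : set (PSL2 R)) (x : R[i])
    (c : seq (PSL2 R * PSL2 R)) : Prop :=
  [/\ forall s, s \in c ->
        [/\ Gamma s.1, Gamma s.2 & simplex_sign x s != 0],
      forall z, upper_half_plane z ->
        exists p, exists2 s, s \in c &
          Gamma p /\ on_translate closed_triangle x p s z,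
      forall z p q i j, Gamma p -> Gamma q ->
        (i < size c)%N -> (j < size c)%N ->
        on_translate open_triangle x p (nth (1%g, 1%g) c i) z ->
        on_translate open_triangle x q (nth (1%g, 1%g) c j) z ->
        p = q /\ i = j &
      forall k : PSL2 R,
        \sum_(s <- c) simplex_sign x s *
          ((s.2 == k)%:R - ((s.1 * s.2)%g == k)%:R + (s.1 == k)%:R) = 0].

Definition evaluation (E : PSL2 R -> PSL2 R -> int) (x : R[i])
    (c : seq (PSL2 R * PSL2 R)) : int :=
  \sum_(s <- c) simplex_sign x s * E s.1 s.2.

(* The surface has genus g: a triangulation with one vertex and F triangles   *)
(* has 3F/2 edges, so that 2 - 2g = 1 - 3F/2 + F.                             *)
Definition has_genus (c : seq (PSL2 R * PSL2 R)) (g : nat) : Prop :=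
  (4 * g = size c + 2)%N.

(* The integral Euler class of PSL(2, R), at the level of cocycles: plus or   *)
(* minus the class of the universal cover, the sign being determined by the   *)
(* value 2 - 2g on the uniformizing representation of a closed surface.       *)
Definition euler_cocycle (E : PSL2 R -> PSL2 R -> int) : Prop :=
  exists eps : int, exists E0 : PSL2 R -> PSL2 R -> int,
    [/\ eps = 1 \/ eps = - 1,
        universal_cover_cocycle E0,
        forall p q, E p q = eps * E0 p q &
        exists Gamma x c g,
          [/\ closed_surface_group Gamma, upper_half_plane x,
              fundamental_cycle Gamma x c, has_genus c g /\ (2 <= g)%N &
              evaluation E x c = 2 - 2 * g%:Z]].

(* Its image in the rational cohomology of PSL(2, Q).                         *)
Definition restrict_to_PSL2Q (E : PSL2 R -> PSL2 R -> int)
    (p q : PSL2 rat) : rat :=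
  (E (PSL2_ratr R p) (PSL2_ratr R q))%:~R.

End EulerClass.

(* Main.v *)
(* Let u(a b; c d) = ((a/c) + (d/c) S) / 12 - s(a/c) for c <> 0, with s the   *)
(* Dedekind sum and S = g^2 / det, g the gcd of the first column; this is     *)
(* Rademacher's function (over 12) extended to PGL+(2, Q). The cocycle is     *)
(*   rho(g1, g2) = -2 (u(g2) - u(g1 g2) + u(g1)) + sign(c1 c2 c12) / 2.       *)
(* Both sides behave in the same way when g1 is multiplied on the left by the *)
(* generators of SL(2, Z), which for u is Dedekind reciprocity, and for g1    *)
(* upper triangular the double sum of rho collapses to a single Dedekind sum  *)
(* by the distribution relation of B_1. The function sign(c1 c2 c12) is minus *)
(* the orientation of (oo, g1 oo, g1 g2 oo), hence a cocycle.                 *)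
(* Counting the half turns made by the lifts of g1, g2, g1 g2 at the angle 0  *)
(* shows that twice the cocycle of the universal cover is a coboundary minus  *)
(* sign(c1 c2 c12). The latter is also, up to a coboundary, a negative        *)
(* multiple of the signed area of the triangle (x, g1 x, g1 g2 x), so the     *)
(* cocycle of the universal cover is positive on every fundamental cycle,     *)
(* and the normalization 2 - 2g selects its opposite.                         *)
Require Import Defs.
From mathcomp Require Import all_boot all_order all_algebra archimedean.
From mathcomp Require Import all_classical all_reals all_analysis.
From mathcomp Require Import complex.
From mathcomp Require Import zify ring lra.

Set Implicit Arguments.
Unset Strict Implicit.
Unset Printing Implicit Defensive.

Import Order.TTheory GRing.Theory Num.Theory.
Import numFieldNormedType.Exports.

Local Open Scope ring_scope.
Local Open Scope quotient_scope.

(** * Periodized Bernoulli functions *)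

(** Write sign for the cochain sign(c1 c2 c12), E0 for a cocycle of the universal cover, u for
    Rademacher's function and d for the coboundary. Two identities carry the proof: rho = -2 du +
    sign/2 ([rho_rademacher]) and 2 E0 = d nu - sign for an integral cochain nu
    ([universal_cover_sign]). The first makes rho a cocycle, since sign comes from the orientation
    of triples of points of the projective line ([sign_cocycle]). Together they give rho = -E0 +
    d(-2u + nu/2).

    For the first identity, the kernels over which rho sums depend on g1 only through SL(2, Z) g1,
    so Euclid's algorithm ([euclid_ind]) reduces g1 to upper triangular form. There the B_2 sums are
    explicit and the double sum becomes one Dedekind sum ([sawtooth_sum_upper]). The function u is
    not invariant under SL(2, Z): by [dedekind_reciprocity] it jumps by quarters, and the sign term
    absorbs these jumps ([sgr_inversion]).

    It remains to see that the Euler class is that of -E0 rather than of E0. The signed hyperbolic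
    area, suitably scaled, differs from -(pi/2) sign by a coboundary ([sign_cochain_area]), hence
    from pi E0 by a coboundary. So E0 is positive on a nonempty fundamental cycle
    ([evaluation_gt0]), whereas 2 - 2g < 0 for g >= 2. *)

Lemma rat_frac_ind (P : rat -> Prop) :
  (forall (t : rat) (m : int), 0 <= t < 1 -> P (t + m%:~R)) -> forall x, P x.
Proof.
move=> H x; rewrite -[x](subrK (Num.floor x)%:~R); apply: H.
by have := floor_itv x; rewrite intrD => /andP[]; lra.
Qed.

Lemma floor_unit_itv (t : rat) (m : int) :
  0 <= t < 1 -> Num.floor (t + m%:~R) = m.
Proof. by move=> t01; apply: floor_def; rewrite intrD; move: t01; lra. Qed.

Lemma int_unit_itv (t : rat) (m : int) :
  0 <= t < 1 -> (t + m%:~R \is a Num.int) = (t == 0).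
Proof.
move=> t01; rewrite intrEfloor floor_unit_itv //.
by apply/eqP/eqP; lra.
Qed.

Lemma periodic_B1E (t : rat) (m : int) : 0 <= t < 1 ->
  periodic_B1 (t + m%:~R) = t - 2^-1 + (t == 0)%:R / 2.
Proof.
move=> t01; rewrite /periodic_B1 int_unit_itv // floor_unit_itv //.
by case: eqP => [->|_] /=; ring.
Qed.

Lemma periodic_B1_unit (t : rat) : 0 <= t < 1 ->
  periodic_B1 t = t - 2^-1 + (t == 0)%:R / 2.
Proof. by move=> /(periodic_B1E 0); rewrite addr0. Qed.

Lemma periodic_B2E (t : rat) (m : int) : 0 <= t < 1 ->
  periodic_B2 (t + m%:~R) = t ^+ 2 - t + 6^-1.
Proof. by move=> t01; rewrite /periodic_B2 floor_unit_itv // addrK. Qed.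

Lemma periodic_B2_unit (t : rat) : 0 <= t < 1 ->
  periodic_B2 t = t ^+ 2 - t + 6^-1.
Proof. by move=> /(periodic_B2E 0); rewrite addr0. Qed.

Lemma periodic_B1_int (m : int) : periodic_B1 m%:~R = 0.
Proof. by rewrite /periodic_B1 intr_int. Qed.

Lemma periodic_B1Dz (x y : rat) :
  y \is a Num.int -> periodic_B1 (x + y) = periodic_B1 x.
Proof.
move=> /intrP[m ->]; elim/rat_frac_ind: x => t n t01.
by rewrite -addrA -intrD !periodic_B1E.
Qed.

Lemma periodic_B2Dz (x y : rat) :
  y \is a Num.int -> periodic_B2 (x + y) = periodic_B2 x.
Proof.
move=> /intrP[m ->]; elim/rat_frac_ind: x => t n t01.
by rewrite -addrA -intrD !periodic_B2E.
Qed.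

Lemma periodic_B1N (x : rat) : periodic_B1 (- x) = - periodic_B1 x.
Proof.
elim/rat_frac_ind: x => t n t01; have [->|t0] := eqVneq t 0.
  by rewrite add0r -intrN !periodic_B1_int oppr0.
have -> : - (t + n%:~R) = (1 - t) + (- n - 1)%:~R.
  by rewrite intrD !intrN; ring.
have t0' : 1 - t != 0 by rewrite subr_eq0; apply/eqP; move: t01; lra.
have t01' : 0 <= 1 - t < 1.
  by move: t01; rewrite [0 <= t]le_eqVlt eq_sym (negPf t0) /=; lra.
by rewrite !periodic_B1E // (negPf t0) (negPf t0') /=; field.
Qed.

(** For polynomials B_1^2 = B_2 + 1/12. The correction at integers is due to the convention that the
    sawtooth takes there the value 0 instead of -1/2. *)
Lemma periodic_B1_sqr (x : rat) :
  periodic_B1 x ^+ 2 = periodic_B2 x + 12^-1 - (x \is a Num.int)%:R / 4.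
Proof.
elim/rat_frac_ind: x => t n t01.
rewrite int_unit_itv // periodic_B1E // periodic_B2E //.
by case: eqP => [->|_] /=; field.
Qed.

(** Replacing x by x + 1 permutes the points (x + l)/n cyclically modulo 1. *)
Lemma sum_shift_periodic (V : zmodType) (f : rat -> V) (n : nat) (x : rat) (m : int) :
  (0 < n)%N -> (forall z, f (z + 1) = f z) ->
  \sum_(0 <= l < n) f ((x + m%:~R + l%:R) / n%:R) =
  \sum_(0 <= l < n) f ((x + l%:R) / n%:R).
Proof.
move=> n0 f1; have n0' : n%:R != 0 :> rat by rewrite pnatr_eq0 -lt0n.
pose g y := \sum_(0 <= l < n) f ((y + l%:R) / n%:R).
have g1 y : g (y + 1) = g y.
  rewrite /g; case: n n0 n0' {g} => // n _ n0'.
  rewrite [RHS]big_nat_recl // [LHS]big_nat_recr //= addrC; congr (_ + _).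
    rewrite -[RHS]f1; congr f; rewrite addr0 -addrA -[1 in LHS]/1%:R.
    by rewrite -natrD add1n; field.
  by apply: eq_bigr => i _; rewrite -addrA -[1 in LHS]/1%:R -natrD add1n.
have gn (k : nat) y : g (y + k%:R) = g y.
  elim: k y => [|k IH] y; first by rewrite addr0.
  by rewrite -natr1 addrA g1 IH.
rewrite -/(g _) -/(g _); case: m => k; first exact: gn.
by rewrite NegzE intrN -(gn k.+1) subrK.
Qed.

Lemma sum_nat_rat (n : nat) :
  \sum_(0 <= l < n) (l%:R : rat) = n%:R * (n%:R - 1) / 2.
Proof.
elim: n => [|n IH]; first by rewrite big_nil; field.
by rewrite big_nat_recr //= IH -natr1; field.
Qed.

Lemma sum_sqr_rat (n : nat) :
  \sum_(0 <= l < n) (l%:R ^+ 2 : rat) = n%:R * (n%:R - 1) * (2 * n%:R - 1) / 6.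
Proof.
elim: n => [|n IH]; first by rewrite big_nil; field.
by rewrite big_nat_recr //= IH -natr1; field.
Qed.

Lemma unit_itv_div (x : rat) (l n : nat) : (l < n)%N -> 0 <= x < 1 ->
  0 <= (x + l%:R) / n%:R < 1.
Proof.
move=> ln x01; have n0 : 0 < n%:R :> rat by rewrite ltr0n (leq_ltn_trans _ ln).
have ln' : l%:R + 1 <= n%:R :> rat by rewrite natr1 ler_nat.
have l0 : 0 <= l%:R :> rat by rewrite ler0n.
by rewrite divr_ge0 ?ltr_pdivrMr ?mul1r //=; move: x01; lra.
Qed.

Lemma periodic_B1_distr (n : nat) (x : rat) : (0 < n)%N ->
  \sum_(0 <= l < n) periodic_B1 ((x + l%:R) / n%:R) = periodic_B1 x.
Proof.
move=> n0; have n0' : n%:R != 0 :> rat by rewrite pnatr_eq0 -lt0n.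
elim/rat_frac_ind: x => t m t01.
rewrite sum_shift_periodic // => [|z]; last exact: periodic_B1Dz.
rewrite periodic_B1E //.
transitivity (\sum_(0 <= l < n)
   ((t / n%:R - 2^-1) + l%:R * n%:R^-1 + ((t == 0) && (l == 0%N))%:R / 2)).
  apply: eq_big_nat => l /andP[_ ln].
  rewrite periodic_B1_unit ?unit_itv_div // mulf_eq0 invr_eq0 (negPf n0') orbF.
  rewrite paddr_eq0 ?ler0n ?pnatr_eq0 //; last by case/andP: t01.
  by rewrite mulrDl; ring.
rewrite big_split big_split /= -[X in _ + X + _]mulr_suml sum_nat_rat.
rewrite sumr_const_nat subn0.
have -> : \sum_(0 <= i < n) (((t == 0) && (i == 0%N))%:R / 2 : rat) = (t == 0)%:R / 2.
  case: n n0 {n0'} => // n _; rewrite big_nat_recl //= eqxx andbT.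
  by rewrite big1 ?addr0 // => i _; rewrite andbF mul0r.
by rewrite -mulr_natr; field.
Qed.

Lemma periodic_B2_distr (n : nat) (x : rat) : (0 < n)%N ->
  \sum_(0 <= l < n) periodic_B2 ((x + l%:R) / n%:R) = periodic_B2 x / n%:R.
Proof.
move=> n0; have n0' : n%:R != 0 :> rat by rewrite pnatr_eq0 -lt0n.
elim/rat_frac_ind: x => t m t01.
rewrite sum_shift_periodic // => [|z]; last exact: periodic_B2Dz.
rewrite periodic_B2E //.
transitivity (\sum_(0 <= l < n)
   (((t / n%:R) ^+ 2 - t / n%:R + 6^-1) + l%:R * ((2 * t / n%:R - 1) / n%:R)
    + l%:R ^+ 2 * n%:R^-2)).
  apply: eq_big_nat => l /andP[_ ln].
  by rewrite periodic_B2_unit ?unit_itv_div //; field.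
rewrite big_split big_split /= -[X in _ + X + _]mulr_suml -[X in _ + X]mulr_suml.
rewrite sum_nat_rat sum_sqr_rat sumr_const_nat subn0.
by rewrite -mulr_natr; field.
Qed.

(** * Dedekind sums *)

Lemma big_nat_mul_split (V : nmodType) (g n : nat) (F : nat -> V) :
  \sum_(0 <= i < g * n) F i =
  \sum_(0 <= i < g) \sum_(0 <= j < n) F (i * n + j)%N.
Proof.
rewrite big_nat_mul; apply: eq_bigr => i _.
rewrite -{1}[(i * n)%N]add0n big_addn mulSnr addKn.
by apply: eq_bigr => j _; rewrite addnC.
Qed.

Lemma natr_rat_neq0 (n : nat) : (0 < n)%N -> n%:R != 0 :> rat.
Proof. by rewrite pnatr_eq0 -lt0n. Qed.

Definition dsum (n : nat) (r : rat) : rat :=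
  \sum_(0 <= j < n) periodic_B1 (j%:R / n%:R) * periodic_B1 (r * j%:R).

Definition dedekind (r : rat) : rat := dsum `|denq r| r.

(** Write the index as i n + j. As r n is an integer, the second factor depends on j only, and the
    distribution relation collapses the sum of the first factor over i. Dedekind sums may therefore
    be computed with any common denominator. *)
Lemma dsum_scale (g n : nat) (r : rat) : (0 < g)%N -> (0 < n)%N ->
  r * n%:R \is a Num.int -> dsum (g * n) r = dsum n r.
Proof.
move=> g0 n0 rn; have g0' := natr_rat_neq0 g0; have n0' := natr_rat_neq0 n0.
rewrite /dsum big_nat_mul_split exchange_big /=; apply: eq_bigr => j _.
rewrite -[in RHS](periodic_B1_distr _ g0) mulr_suml; apply: eq_bigr => i _.
congr (periodic_B1 _ * _); first by rewrite natrD !natrM; field; rewrite g0' n0'.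
rewrite natrD natrM mulrDr addrC periodic_B1Dz //.
by rewrite [i%:R * _]mulrC mulrA rpredM ?natr_int.
Qed.

Lemma absz_denq_gt0 (r : rat) : (0 < `|denq r|)%N.
Proof. by rewrite absz_gt0 denq_eq0. Qed.

Lemma natr_absz_denq (r : rat) : (`|denq r|%N)%:R = (denq r)%:~R :> rat.
Proof. by rewrite -[in RHS]absz_denq. Qed.

Lemma dsum_dedekind (n : nat) (r : rat) : (0 < n)%N ->
  r * n%:R \is a Num.int -> dsum n r = dedekind r.
Proof.
move=> n0 /intrP[m rn].
have /dvdnP[g gE] : (`|denq r| %| n)%N.
  rewrite -(@Gauss_dvdr _ `|numq r|) 1?coprime_sym ?coprime_num_den //.
  have : numq r * n%:Z = m * denq r.
    apply: (@intr_inj rat); rewrite !intrM -rn numqE /=.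
    by rewrite mulrAC.
  by move=> /(congr1 absz); rewrite !abszM => ->; apply: dvdn_mull.
move: n0; rewrite gE muln_gt0 => /andP[g0 d0].
by rewrite dsum_scale // natr_absz_denq -numqE intr_int.
Qed.

Lemma dedekindDz (r : rat) (m : int) : dedekind (r + m%:~R) = dedekind r.
Proof.
rewrite -(@dsum_dedekind `|denq r|) ?absz_denq_gt0 //.
  apply: eq_bigr => j _; rewrite mulrDl periodic_B1Dz //.
  by rewrite rpredM ?intr_int ?natr_int.
by rewrite natr_absz_denq mulrDl -numqE rpredD ?rpredM ?intr_int.
Qed.

Lemma dedekind_opp (r : rat) : dedekind (- r) = - dedekind r.
Proof.
rewrite /dedekind denqN -sumrN; apply: eq_bigr => j _.
by rewrite mulNr periodic_B1N mulrN.
Qed.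

Lemma periodic_B1_0 : periodic_B1 0 = 0.
Proof. exact: (periodic_B1_int 0). Qed.

Lemma dedekind_int (m : int) : dedekind m%:~R = 0.
Proof.
by rewrite /dedekind denq_int /dsum big_nat1 mul0r.
Qed.

(* The square is 1/4 because the sum of the three sawtooth values is then     *)
(* congruent to 1/2 modulo 1 and of absolute value less than 3/2.             *)
Lemma periodic_B1_triple (x y : rat) :
  (periodic_B1 x + periodic_B1 y - periodic_B1 (x + y)) ^+ 2 =
  (1 - (x \is a Num.int)%:R) * (1 - (y \is a Num.int)%:R)
    * (1 - (x + y \is a Num.int)%:R) / 4.
Proof.
elim/rat_frac_ind: x => t m t01; elim/rat_frac_ind: y => s n s01.
rewrite addrACA -intrD (int_unit_itv m t01) (int_unit_itv n s01).
rewrite (periodic_B1E m t01) (periodic_B1E n s01).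
have [ts1|ts1] := ltrP (t + s) 1.
  have ts01 : 0 <= t + s < 1 by move: t01 s01 ts1; lra.
  rewrite int_unit_itv // periodic_B1E //.
  have -> : (t + s == 0) = (t == 0) && (s == 0).
    by rewrite paddr_eq0 //; move: t01 s01; lra.
  by case: eqP => [->|_]; case: eqP => [->|_] /=; field.
have -> : t + s + (m + n)%:~R = (t + s - 1) + (m + n + 1)%:~R.
  by rewrite !intrD; ring.
have ts01 : 0 <= t + s - 1 < 1 by move: t01 s01 ts1; lra.
rewrite int_unit_itv // periodic_B1E //.
have -> : (t == 0) = false by apply/eqP; move: t01 s01 ts1; lra.
have -> : (s == 0) = false by apply/eqP; move: t01 s01 ts1; lra.
by case: eqP => [ts|_] /=; [have -> : t = 1 - s by move: ts; lra|]; field.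
Qed.

(** Multiplication by k permutes the residues modulo h. *)
Lemma sum_B2_coprime (h k : nat) : (0 < h)%N -> coprime k h ->
  \sum_(0 <= i < h) periodic_B2 (k%:R * (i%:R / h%:R)) =
  \sum_(0 <= i < h) periodic_B2 (i%:R / h%:R).
Proof.
move=> h0 kh; have h0' := natr_rat_neq0 h0.
pose f (i : 'I_h) := Ordinal (ltn_pmod (k * i) h0).
have f_inj : injective f.
  have aux (a b : 'I_h) : (a <= b)%N -> f a = f b -> a = b.
    move=> ab /(congr1 val) /= /esym /eqP; rewrite eqn_mod_dvd ?leq_mul2l ?ab ?orbT //.
    rewrite -mulnBr Gauss_dvdr 1?coprime_sym // => hd; apply/val_inj => /=.
    apply/eqP; rewrite eqn_leq ab /= -subn_eq0.
    case: (posnP (b - a)) => // ba0; have := dvdn_leq ba0 hd.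
    by have := ltn_ord b; lia.
  move=> a b fab; case: (leqP a b) => [ab|/ltnW ba]; first exact: aux.
  by apply/esym/aux.
rewrite !big_mkord [RHS](reindex_inj f_inj) /=; apply: eq_bigr => i _.
rewrite mulrA -natrM {1}(divn_eq (k * i) h) natrD natrM mulrDl mulfK //.
by rewrite addrC periodic_B2Dz ?natr_int.
Qed.

Lemma sum_B2_nat (n : nat) : (0 < n)%N ->
  \sum_(0 <= i < n) periodic_B2 (i%:R / n%:R) = (6 * n%:R)^-1.
Proof.
move=> n0; have n0' := natr_rat_neq0 n0; have := @periodic_B2_distr n 0 n0.
under eq_bigr do rewrite add0r; move=> ->.
by rewrite periodic_B2_unit //; field.
Qed.

Lemma sum_nat_eq0 (n : nat) : (0 < n)%N ->
  \sum_(0 <= i < n) ((i == 0%N)%:R : rat) = 1.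
Proof. by case: n => // n _; rewrite big_nat_recl //= big1 ?addr0. Qed.

Lemma nat_div_int (i n : nat) : (i < n)%N ->
  ((i%:R / n%:R : rat) \is a Num.int) = (i == 0%N).
Proof.
move=> lin; have := @int_unit_itv (i%:R / n%:R) 0; rewrite addr0 => ->.
  have n0 := natr_rat_neq0 (leq_ltn_trans (leq0n _) lin).
  by rewrite mulf_eq0 invr_eq0 (negPf n0) orbF pnatr_eq0.
by have := @unit_itv_div 0 i n lin; rewrite add0r; apply.
Qed.

Lemma sum_B1_sqr_nat (n : nat) : (0 < n)%N ->
  \sum_(0 <= i < n) periodic_B1 (i%:R / n%:R) ^+ 2 =
  (6 * n%:R)^-1 + n%:R / 12 - 4^-1.
Proof.
move=> n0; transitivity (\sum_(0 <= i < n)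
    (periodic_B2 (i%:R / n%:R) + 12^-1 - (i == 0%N)%:R / 4)).
  by apply: eq_big_nat => i /andP[_ lin]; rewrite periodic_B1_sqr nat_div_int.
rewrite sumrB big_split /= sum_B2_nat // -mulr_suml sum_nat_eq0 // mul1r.
by rewrite sumr_const_nat subn0 -[_ *+ n]mulr_natl; ring.
Qed.

Lemma sum_nat_div_eq0 (h k i j : nat) : (i < h)%N -> (j < k)%N -> coprime h k ->
  ((i%:R / h%:R + j%:R / k%:R : rat) \is a Num.int) = (i == 0%N) && (j == 0%N).
Proof.
move=> ih jk hk; have h0 := natr_rat_neq0 (leq_ltn_trans (leq0n _) ih).
have k0 := natr_rat_neq0 (leq_ltn_trans (leq0n _) jk).
apply/idP/andP => [|[/eqP-> /eqP->]]; last by rewrite !mul0r addr0 rpred0.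
move=> z; have i0 : i == 0%N.
  have /intrP[m mE] := z; have : (h %| i * k)%N.
    have E : (i * k)%N%:Z = (m * k%:Z - j%:Z) * h%:Z.
      apply: (@intr_inj rat); rewrite intrM intrB intrM /= -mE.
      have -> : ((i * k)%N%:Z%:~R : rat) = i%:R * k%:R by rewrite -natrM.
      by rewrite -!pmulrn; field; rewrite h0 k0.
    by have /dvdzP : exists q, (i * k)%N%:Z = q * h%:Z by exists (m * k%:Z - j%:Z).
  rewrite Gauss_dvdl // => hi; rewrite -leqn0 leqNgt; apply/negP => i0.
  by have := dvdn_leq i0 hi; rewrite leqNgt ih.
by split=> //; move: z; rewrite (eqP i0) mul0r add0r nat_div_int.
Qed.

(** With x = i/h and y = j/k, the square of b(x) + b(y) - b(x + y) is summed over the box in two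
    ways. By [periodic_B1_triple] the sum is (h - 1)(k - 1)/4. After expansion, the squares are B_2
    sums, the product b(x) b(y) sums to 0, and the distribution relation turns the products with b(x
    + y) into the two Dedekind sums. *)
Lemma dedekind_reciprocity (h k : nat) :
  (0 < h)%N -> (0 < k)%N -> coprime h k ->
  dedekind (h%:R / k%:R) + dedekind (k%:R / h%:R) =
  (h%:R / k%:R + k%:R / h%:R + (h%:R * k%:R)^-1) / 12 - 4^-1.
Proof.
move=> h0 k0 hk; have h0' := natr_rat_neq0 h0; have k0' := natr_rat_neq0 k0.
pose x (i : nat) : rat := i%:R / h%:R; pose y (j : nat) : rat := j%:R / k%:R.
pose b := periodic_B1.
pose S F := \sum_(0 <= i < h) \sum_(0 <= j < k) (F i j : rat).
have SD F G : S (fun i j => F i j + G i j) = S F + S G.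
  by rewrite /S -big_split; apply: eq_bigr => i _; rewrite big_split.
have SN F : S (fun i j => - F i j) = - S F.
  by rewrite /S -sumrN; apply: eq_bigr => i _; rewrite sumrN.
have SM c F : S (fun i j => c * F i j) = c * S F.
  by rewrite /S mulr_sumr; apply: eq_bigr => i _; rewrite mulr_sumr.
have S1 (F : nat -> rat) : S (fun i _ => F i) = k%:R * \sum_(0 <= i < h) F i.
  by rewrite /S mulr_sumr; apply: eq_bigr => i _; rewrite sumr_const_nat subn0 mulr_natl.
have S2 (F : nat -> rat) : S (fun _ j => F j) = h%:R * \sum_(0 <= j < k) F j.
  by rewrite /S sumr_const_nat subn0 mulr_natl.
have SP (F G : nat -> rat) : S (fun i j => F i * G j) =
    (\sum_(0 <= i < h) F i) * \sum_(0 <= j < k) G j.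
  by rewrite /S mulr_suml; apply: eq_bigr => i _; rewrite mulr_sumr.
have B0 n : (0 < n)%N -> \sum_(0 <= i < n) b (i%:R / n%:R) = 0.
  move=> n0; have := @periodic_B1_distr n 0 n0.
  by under eq_bigr do rewrite add0r; rewrite periodic_B1_0.
have xb : S (fun i j => b (x i) * b (x i + y j)) = dedekind (k%:R / h%:R).
  rewrite -(@dsum_dedekind h) ?divfK ?natr_int //; apply: eq_bigr => i _.
  rewrite -mulr_sumr; congr (_ * _).
  rewrite -[RHS](periodic_B1_distr _ k0); apply: eq_bigr => j _.
  by congr b; rewrite /x /y; field; rewrite h0' k0'.
have yb : S (fun i j => b (y j) * b (x i + y j)) = dedekind (h%:R / k%:R).
  rewrite -(@dsum_dedekind k) ?divfK ?natr_int // /S exchange_big.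
  apply: eq_bigr => i _; rewrite -mulr_sumr; congr (_ * _).
  rewrite -[RHS](periodic_B1_distr _ h0); apply: eq_bigr => j _.
  by congr b; rewrite /x /y; field; rewrite h0' k0'.
pose z (i : nat) : rat := (i == 0%N)%:R.
have zb : S (fun i j => b (x i + y j) ^+ 2) =
    (6 * (h%:R * k%:R))^-1 + h%:R * k%:R / 12 - 4^-1.
  transitivity (S (fun i j => periodic_B2 (x i + y j) + (12^-1 - 4^-1 * (z i * z j)))).
    apply: eq_big_nat => i /andP[_ ih]; apply: eq_big_nat => j /andP[_ jk].
    by rewrite periodic_B1_sqr sum_nat_div_eq0 // -mulnb natrM /z; ring.
  rewrite SD (SD (fun _ _ => 12^-1)) SN SM SP !sum_nat_eq0 //.
  rewrite (S1 (fun _ => 12^-1)) sumr_const_nat subn0.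
  have -> : S (fun i j => periodic_B2 (x i + y j)) = (6 * (h%:R * k%:R))^-1.
    transitivity (\sum_(0 <= i < h) periodic_B2 (k%:R * (i%:R / h%:R)) / k%:R).
      apply: eq_bigr => i _; rewrite -periodic_B2_distr //; apply: eq_bigr => j _.
      by congr periodic_B2; rewrite /x /y; field; rewrite h0' k0'.
    by rewrite -mulr_suml sum_B2_coprime 1?coprime_sym // sum_B2_nat //; field; rewrite h0' k0'.
  by rewrite -mulr_natl; field; rewrite h0' k0'.
have : S (fun i j => (b (x i) + b (y j) - b (x i + y j)) ^+ 2) =
       S (fun i j => 4^-1 * ((1 - z i) * (1 - z j))).
  apply: eq_big_nat => i /andP[_ ih]; apply: eq_big_nat => j /andP[_ jk].
  rewrite periodic_B1_triple sum_nat_div_eq0 // !nat_div_int // /z.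
  by case: eqP; case: eqP => _ _ /=; ring.
rewrite SM SP !sumrB !sumr_const_nat !subn0 !sum_nat_eq0 //.
have -> : S (fun i j => (b (x i) + b (y j) - b (x i + y j)) ^+ 2) =
  S (fun i j => b (x i) ^+ 2 + (b (y j) ^+ 2 + (b (x i + y j) ^+ 2 +
     (2 * (b (x i) * b (y j)) + (- 2 * (b (x i) * b (x i + y j)) +
       -2 * (b (y j) * b (x i + y j))))))).
  by apply: eq_bigr => i _; apply: eq_bigr => j _; ring.
rewrite !SD !SM (S1 (fun i => b (x i) ^+ 2)) (S2 (fun i => b (y i) ^+ 2)).
rewrite !sum_B1_sqr_nat // zb xb yb SP !B0 // => E.
rewrite -[dedekind _ + _](mulKf (_ : 2 != 0)) // mulrDr.
have -> : 2 * dedekind (h%:R / k%:R) + 2 * dedekind (k%:R / h%:R) =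
  k%:R * ((6 * h%:R)^-1 + h%:R / 12 - 4^-1) +
  h%:R * ((6 * k%:R)^-1 + k%:R / 12 - 4^-1) +
  ((6 * (h%:R * k%:R))^-1 + h%:R * k%:R / 12 - 4^-1)
  - 4^-1 * ((h%:R - 1) * (k%:R - 1)) by move: E; lra.
by field; rewrite h0' k0'.
Qed.

(** * The sums over (Q/Z)^2 *)

Definition mx2 (F : Type) (a b c d : F) : 'M[F]_2 :=
  \matrix_(i < 2, j < 2)
    (if i == 0 then if j == 0 then a else b else if j == 0 then c else d).

Lemma ord2_ind (P : 'I_2 -> Prop) : P 0 -> P 1 -> forall i, P i.
Proof.
move=> P0 P1 [[|[|//]] i].
  by have -> : Ordinal i = 0 by apply/val_inj.
by have -> : Ordinal i = 1 by apply/val_inj.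
Qed.

Lemma mx2_eta (F : Type) (M : 'M[F]_2) :
  M = mx2 (M 0 0) (M 0 1) (M 1 0) (M 1 1).
Proof.
by apply/matrixP; elim/ord2_ind; elim/ord2_ind; rewrite mxE.
Qed.

Lemma mulmx2E (F : pzRingType) (m n : nat) (A : 'M[F]_(m, 2)) (B : 'M[F]_(2, n)) i j :
  (A *m B) i j = A i 0 * B 0 j + A i 1 * B 1 j.
Proof.
rewrite mxE !big_ord_recl big_ord0 addr0.
by congr (_ + A i _ * B _ j); apply/val_inj.
Qed.

Lemma mulmx2 (F : pzRingType) (a b c d a' b' c' d' : F) :
  mx2 a b c d *m mx2 a' b' c' d' =
  mx2 (a * a' + b * c') (a * b' + b * d') (c * a' + d * c') (c * b' + d * d').
Proof.
by apply/matrixP; elim/ord2_ind; elim/ord2_ind; rewrite mulmx2E !mxE.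
Qed.

Lemma map_mx2 (F G : Type) (f : F -> G) (a b c d : F) :
  map_mx f (mx2 a b c d) = mx2 (f a) (f b) (f c) (f d).
Proof. by apply/matrixP; elim/ord2_ind; elim/ord2_ind; rewrite !mxE. Qed.

Lemma det2 (F : comPzRingType) (a b c d : F) : \det (mx2 a b c d) = a * d - b * c.
Proof.
rewrite (expand_det_row _ 0) !big_ord_recl big_ord0 addr0 /cofactor !det_mx11.
by rewrite !mxE /= expr0 expr1; ring.
Qed.

Lemma check_mx2 (a b c d : rat) : a * d - b * c != 0 ->
  check (mx2 a b c d) = mx2 d (- b) (- c) a.
Proof.
move=> D; have U : mx2 a b c d \in unitmx by rewrite unitmxE det2 unitfE.
rewrite /check det2 -[RHS]mulmx1 -(mulmxV U) mulmxA mulmx2.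
have -> : mx2 (d * a + - b * c) (d * b + - b * d) (- c * a + a * c)
     (- c * b + a * d) = (a * d - b * c)%:M.
  by apply/matrixP; elim/ord2_ind; elim/ord2_ind; rewrite !mxE /=; ring.
by rewrite mul_scalar_mx.
Qed.

(** [U] is invertible over the integers, so y N is integral exactly when y N U is. *)
Lemma QZ_kernel_mulr (N U V : 'M[rat]_2) :
  (forall i j, U i j \is a Num.int) -> (forall i j, V i j \is a Num.int) ->
  U *m V = 1%:M -> QZ_kernel (N *m U) = QZ_kernel N.
Proof.
move=> Uint Vint UV; have aux (W : 'M[rat]_2) (y : 'rV[rat]_2) :
    (forall i j, W i j \is a Num.int) -> (forall i, y 0 i \is a Num.int) ->
    forall i, (y *m W) 0 i \is a Num.int.
  by move=> Wint yint i; rewrite mulmx2E rpredD ?rpredM.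
apply/seteqP; split=> y [y01 yN]; split=> // i; last by rewrite mulmxA; apply: aux.
by rewrite -[y *m N]mulmx1 -UV !mulmxA -[y *m N *m U]mulmxA; apply: aux.
Qed.

Definition fract (x : rat) : rat := x - (Num.floor x)%:~R.

Lemma fract_itv (x : rat) : 0 <= fract x < 1.
Proof. by have := floor_itv x; rewrite /fract intrD; lra. Qed.

Lemma fract_eq (x y : rat) : 0 <= x < 1 -> x - y \is a Num.int -> x = fract y.
Proof.
move=> x01 /intrP[m xy]; have -> : y = x + (- m)%:~R by rewrite intrN -xy; ring.
by rewrite /fract floor_unit_itv // addrK.
Qed.

Lemma fract_int (x : rat) : x - fract x \is a Num.int.
Proof. by rewrite /fract subKr intr_int. Qed.

Definition row2 (x y : rat) : 'rV[rat]_2 := \row_(j < 2) (if j == 0 then x else y).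

(** For the matrix with rows (a, b) and (0, d), the kernel equation reads d y_1 = 0 and a y_2 = b
    y_1 modulo Z. Hence y_1 = k/d, and l numbers the a solutions y_2 above it. *)
Definition upper_kernel_seq (a d : nat) (b : int) : seq 'rV[rat]_2 :=
  [seq row2 (k%:R / d%:R) (fract ((b%:~R * (k%:R / d%:R) + l%:R) / a%:R))
     | k <- iota 0 d, l <- iota 0 a].

Lemma nat_div_itv (i n : nat) : (i < n)%N -> 0 <= (i%:R / n%:R : rat) < 1.
Proof. by move=> lin; have := @unit_itv_div 0 i n lin; rewrite add0r; apply. Qed.

Lemma QZ_kernel_upper (a d : nat) (b : int) : (0 < a)%N -> (0 < d)%N ->
  QZ_kernel (check (mx2 a%:R b%:~R 0 d%:R)) = [set` upper_kernel_seq a d b]%classic.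
Proof.
move=> a0 d0; have a0' := natr_rat_neq0 a0; have d0' := natr_rat_neq0 d0.
rewrite check_mx2 ?mulr0 ?subr0 ?mulf_neq0 //; apply/seteqP; split=> y /=.
  move=> [y01 yN]; have := yN 0; have := yN 1; rewrite !mulmx2E !mxE /=.
  rewrite oppr0 mulr0 addr0 => /intrP[n nE] /intrP[m mE].
  have y0E : y 0 0 = m%:~R / d%:R by rewrite -mE mulfK.
  have /andP[y00 y01'] := y01 0.
  have m0 : 0 <= m by rewrite -(ler0z rat) -mE mulr_ge0.
  have {m0} [k kE] : exists k : nat, m = k by exists `|m|%N; rewrite gez0_abs.
  have kd : (k < d)%N by rewrite -(ltr_nat rat) -[k%:R]/(k%:Z%:~R) -kE -mE gtr_pMl ?ltr0n.
  have a0z : a%:Z != 0 by lia.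
  have [l lE] : exists l : nat, (n %% a)%Z = l.
    by exists `|(n %% a)%Z|%N; rewrite gez0_abs // modz_ge0.
  have la : (l < a)%N by have := ltz_pmod n (_ : 0 < a%:Z); rewrite lE ltz_nat; apply.
  apply/allpairsP; exists (k, l); rewrite !mem_iota; split=> //=.
  apply/rowP; elim/ord2_ind; rewrite mxE /=; first by rewrite y0E kE.
  apply: fract_eq; first exact: y01.
  have -> : y 0 1 = (n%:~R + b%:~R * (k%:R / d%:R)) / a%:R.
    by rewrite -nE y0E kE; field; rewrite a0' d0'.
  rewrite (divz_eq n a) lE intrD intrM.
  set q := (n %/ a)%Z; rewrite (_ : _ - _ = q%:~R) ?intr_int //.
  by rewrite -!pmulrn; field; rewrite a0' d0'.
move=> /allpairsP[[k l] /= []]; rewrite !mem_iota !add0n /= => kd la ->; split.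
  by elim/ord2_ind; rewrite mxE /= ?nat_div_itv ?fract_itv.
elim/ord2_ind; rewrite mulmx2E !mxE /=.
  by rewrite oppr0 mulr0 addr0 divfK // natr_int.
set z := (_ / a%:R); have -> : fract z = z - (z - fract z) by rewrite subKr.
rewrite mulrBl addrCA addrA rpredB ?rpredM ?fract_int ?natr_int //.
by rewrite (_ : _ + _ = l%:R) ?natr_int // /z; field; rewrite a0' d0'.
Qed.

Lemma upper_kernel_uniq (a d : nat) (b : int) : (0 < a)%N -> (0 < d)%N ->
  uniq (upper_kernel_seq a d b).
Proof.
move=> a0 d0; have a0' := natr_rat_neq0 a0; have d0' := natr_rat_neq0 d0.
apply: allpairs_uniq; rewrite ?iota_uniq // => p p'.
move=> /allpairsP[[k l] /= [h1 h2 ->]] /allpairsP[[k' l'] /= [h3 h4 ->]].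
move: h1 h2 h3 h4; rewrite !mem_iota !add0n /= => kd la kd' la' /rowP E.
have := E 0; rewrite !mxE /= => /(mulIf (invr_neq0 d0')) /eqP.
rewrite eqr_nat => /eqP kk'; rewrite -{}kk' in E *.
have := E 1; rewrite !mxE /=; set z := (_ / a%:R); set z' := (_ / a%:R) => zz'.
have : z - z' \is a Num.int.
  have -> : z - z' = (z - fract z) - (z' - fract z') by rewrite zz'; ring.
  by rewrite rpredB ?fract_int.
have -> : z - z' = (l%:R - l'%:R) / a%:R by rewrite /z /z'; field; rewrite a0' d0'.
move=> /intrP[m mE]; have : (l%:Z - l'%:Z = m * a%:Z).
  by apply: (@intr_inj rat); rewrite intrB intrM -mE divfK.
move: la la' => {kd kd' zz' z z' mE E p p'} la la' ll'; congr (_, _).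
have m0 : m = 0 by case: (ltgtP m 0) => // hm; nia.
by move: ll'; rewrite m0 mul0r => /eqP; rewrite subr_eq0 eqz_nat => /eqP.
Qed.

Lemma sum_QZ_kernel_upper (V : nmodType) (a d : nat) (b : int)
    (F : rat -> rat -> V) : (0 < a)%N -> (0 < d)%N ->
  (forall x y z, y - z \is a Num.int -> F x y = F x z) ->
  \sum_(y \in QZ_kernel (check (mx2 a%:R b%:~R 0 d%:R))) F (y 0 0) (y 0 1) =
  \sum_(0 <= k < d) \sum_(0 <= l < a)
    F (k%:R / d%:R) ((b%:~R * (k%:R / d%:R) + l%:R) / a%:R).
Proof.
move=> a0 d0 FE; rewrite QZ_kernel_upper // -fsbig_seq ?upper_kernel_uniq //.
rewrite big_allpairs_dep /= /index_iota !subn0.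
apply: eq_bigr => k _; apply: eq_bigr => l _; rewrite !mxE /=; apply: FE.
by rewrite -opprB rpredN fract_int.
Qed.

(** * The Rademacher function on PGL+(2, Q) *)

(** Euclid's algorithm on the first column, by translations and the inversion of SL(2, Z) acting on
    the left; it ends at an upper triangular matrix with positive diagonal. *)
Lemma euclid_ind (P : int -> int -> int -> int -> Prop) :
  (forall (a d : nat) (b : int), (0 < a)%N -> (0 < d)%N -> P a b 0 d) ->
  (forall a b c d m : int, 0 < a * d - b * c ->
     P a b c d -> P (a + m * c) (b + m * d) c d) ->
  (forall a b c d : int, 0 < a * d - b * c -> P a b c d -> P (- c) (- d) a b) ->
  forall a b c d, 0 < a * d - b * c -> P a b c d.
Proof.
move=> Pup PT PS a b c d; move: {2}`|c|%N (leqnn `|c|%N) => n.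
elim/ltn_ind: n a b c d => n IH a b c d cn D.
have [c0|c0] := eqVneq c 0.
  move: D cn; rewrite {}c0 mulr0 subr0 => D _.
  have [a0|a0] := ltrP 0 a.
    have d0 : 0 < d by nia.
    by move: (Pup `|a|%N `|d|%N b); rewrite !gtz0_abs // !absz_gt0; apply; lia.
  (* Here a and d are both negative; the inversion applied twice negates the matrix. *)
  have := Pup `|a|%N `|d|%N (- b).
  have -> : `|a|%N = - a :> int by lia.
  have -> : `|d|%N = - d :> int by nia.
  move=> /(_ _ _)/PS; rewrite !oppr0 => H.
  have := PS _ _ _ _ _ (H _ _ _); rewrite !opprK; apply; nia.
(* The matrix with first column (c, -r) has a smaller lower left entry; inversion and then
   translation by q lead from it back to the given one. *)
set q := (a %/ c)%Z; set r := (a %% c)%Z.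
have rE : a = r + q * c by rewrite addrC; apply: divz_eq.
have r0 : 0 <= r by apply: modz_ge0.
have rc : r < `|c| by apply: ltz_mod.
have -> : b = (b - q * d) + q * d by rewrite subrK.
rewrite rE; apply: PT; first by move: D; rewrite rE; lia.
have := PS c d (- r) (- (b - q * d)); rewrite !opprK; apply; first by move: D; rewrite rE; lia.
by apply: (IH `|r|%N); [lia|lia|move: D; rewrite rE; lia].
Qed.

(* For integral entries this is the squared gcd of the first column divided   *)
(* by the determinant.                                                        *)
Definition content_ratio (a b c d : rat) : rat :=
  if c == 0 then a / d
  else c ^+ 2 / ((denq (a / c))%:~R ^+ 2 * (a * d - b * c)).

(* Rademacher's function divided by 12, extended to PGL+(2, Q).               *)
Definition rademacher (a b c d : rat) : rat :=
  if c == 0 then b / d / 12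
  else (a / c + d / c * content_ratio a b c d) / 12 - dedekind (a / c).

Lemma denqDz (r : rat) (m : int) : denq (r + m%:~R) = denq r.
Proof.
have aux (s : rat) (n : int) : (`|denq (s + n%:~R)| %| `|denq s|)%N.
  rewrite -(@Gauss_dvdr _ `|numq (s + n%:~R)|) 1?coprime_sym ?coprime_num_den //.
  have : numq (s + n%:~R) * denq s = (numq s + n * denq s) * denq (s + n%:~R).
    by apply: (@intr_inj rat); rewrite !(intrM, intrD) !numqE; ring.
  by move=> /(congr1 absz); rewrite !abszM => ->; apply: dvdn_mull.
have E : `|denq (r + m%:~R)|%N = `|denq r|%N.
  apply/eqP; rewrite eqn_dvd aux /=.
  by have := aux (r + m%:~R) (- m); rewrite intrN addrK.
by rewrite -[LHS]absz_denq -[RHS]absz_denq E.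
Qed.

Lemma denqV (r : rat) : r != 0 -> denq r^-1 = `|numq r|.
Proof.
move=> r0; have n0 : numq r != 0 by rewrite numq_eq0.
have {1}<- := divq_num_den r; rewrite invf_div.
have := den_fracq (denq r, numq r); rewrite fracqE /= n0 => ->.
by rewrite gcdnC (eqP (coprime_num_den r)) divn1.
Qed.

(** Both sides are odd in r, which reduces the claim to positive r. *)
Lemma dedekind_reciprocity_rat (r : rat) : r != 0 ->
  dedekind r + dedekind r^-1 =
  (r + r^-1 + (numq r)%:~R^-1 * (denq r)%:~R^-1) / 12 - Num.sg r / 4.
Proof.
have pos (s : rat) : 0 < s -> dedekind s + dedekind s^-1 =
    (s + s^-1 + (numq s)%:~R^-1 * (denq s)%:~R^-1) / 12 - 4^-1.
  move=> s0; have n0 : 0 < numq s by rewrite numq_gt0.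
  have := dedekind_reciprocity _ (absz_denq_gt0 s) (coprime_num_den s).
  rewrite !natr_absz_denq absz_gt0 gt_eqF // => /(_ isT).
  have -> : `|numq s|%N%:R = (numq s)%:~R :> rat by rewrite -[in RHS](gtz0_abs n0).
  rewrite divq_num_den => H; move: H.
  by rewrite -[(denq s)%:~R / _]invf_div divq_num_den invfM.
move=> r0; case: (ltrgtP r 0) r0 => // rs _; last by rewrite pos // gtr0_sg ?mul1r.
have := pos (- r); rewrite oppr_gt0 => /(_ rs).
rewrite invrN !dedekind_opp numqN denqN intrN invrN ltr0_sg //; lra.
Qed.

Lemma content_ratioT (a b c d : rat) (m : int) :
  content_ratio (a + m%:~R * c) (b + m%:~R * d) c d = content_ratio a b c d.
Proof.
rewrite /content_ratio; case: eqVneq => [->|c0]; first by rewrite mulr0 addr0.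
rewrite mulrDl mulfK // denqDz; congr (_ / (_ * _)); ring.
Qed.

(** Both sides are the square of a generator of the group a Z + c Z. *)
Lemma sqr_denqV (a c : rat) : a != 0 -> c != 0 ->
  a ^+ 2 / (denq (c / a))%:~R ^+ 2 = c ^+ 2 / (denq (a / c))%:~R ^+ 2.
Proof.
move=> a0 c0; have -> : c / a = (a / c)^-1 by rewrite invf_div.
rewrite denqV ?mulf_neq0 ?invr_neq0 //.
have -> : ((`|numq (a / c)| : int)%:~R ^+ 2 : rat) = (numq (a / c))%:~R ^+ 2.
  by rewrite intr_norm real_normK // num_real.
rewrite numqE; have : ((denq (a / c))%:~R : rat) != 0 by rewrite intr_eq0 denq_neq0.
by move=> D0; field; rewrite a0 c0 D0.
Qed.

Lemma content_ratioS (a b c d : rat) : a * d - b * c != 0 ->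
  content_ratio (- c) (- d) a b = content_ratio a b c d.
Proof.
move=> D; rewrite /content_ratio.
have [a0|a0] := eqVneq a 0; have [c0|c0] := eqVneq c 0.
- by move: D; rewrite a0 c0 mul0r mulr0 subr0 eqxx.
- move: D; rewrite a0 mul0r sub0r oppr_eq0 mulf_eq0 negb_or => /andP[b0 _].
  by rewrite mul0r -[0]/(0%:~R) denq_int expr1n; field; rewrite b0 c0.
- move: D; rewrite c0 mulr0 subr0 mulf_eq0 negb_or => /andP[_ d0].
  by rewrite oppr0 mul0r -[0]/(0%:~R) denq_int expr1n; field; rewrite a0 d0.
rewrite mulNr denqN (_ : - c * b - - d * a = a * d - b * c); last by ring.
by rewrite !(invfM (_ ^+ 2) (_ - _)) !mulrA sqr_denqV.
Qed.

Lemma rademacherT (a b c d : rat) (m : int) : a * d - b * c != 0 ->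
  rademacher (a + m%:~R * c) (b + m%:~R * d) c d = rademacher a b c d + m%:~R / 12.
Proof.
move=> D; rewrite /rademacher content_ratioT.
case: (eqVneq c 0) D => [->|c0] D.
  have d0 : d != 0 by apply: contraNneq D => ->; rewrite !mulr0 subr0.
  by field.
have -> : (a + m%:~R * c) / c = a / c + m%:~R by rewrite mulrDl mulfK.
by rewrite dedekindDz; field.
Qed.

(** For a c != 0 this is reciprocity for a/c, whose term 1/(numerator times denominator) accounts
    for the content ratio. When a or c is 0 the Dedekind sum that occurs is 0 and one side is in its
    upper triangular branch. *)
Lemma rademacherS (a b c d : rat) : a * d - b * c != 0 ->
  rademacher (- c) (- d) a b = rademacher a b c d - Num.sg (a * c) / 4.
Proof.
move=> D; rewrite /rademacher content_ratioS //.
have [a0|a0] := eqVneq a 0; have [c0|c0] := eqVneq c 0.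
- by move: D; rewrite a0 c0 mul0r mulr0 subr0 eqxx.
- move: D; rewrite a0 mul0r sub0r oppr_eq0 mulf_eq0 negb_or => /andP[b0 _].
  rewrite !mul0r ?sgr0 ?mul0r subr0 /content_ratio (negPf c0) ?mul0r sub0r.
  rewrite -[0]/(0%:~R) dedekind_int denq_int expr1n.
  by field; rewrite b0 c0.
- move: D; rewrite c0 mulr0 subr0 mulf_eq0 negb_or => /andP[_ d0].
  rewrite mulr0 /content_ratio eqxx sgr0 oppr0 mul0r.
  rewrite -[0]/(0%:~R) dedekind_int.
  by field; rewrite a0 d0.
have ac : a / c != 0 by rewrite mulf_neq0 ?invr_neq0.
have := dedekind_reciprocity_rat ac.
have -> : Num.sg (a / c) = Num.sg (a * c) by rewrite !sgrM sgrV.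
have q0 : ((denq (a / c))%:~R : rat) != 0 by rewrite intr_eq0 denq_neq0.
rewrite numqE invf_div mulNr dedekind_opp /content_ratio (negPf c0) => H.
have -> : dedekind (c / a) = - dedekind (a / c) +
  ((a / c + c / a + (a / c * (denq (a / c))%:~R)^-1 / (denq (a / c))%:~R) / 12 - Num.sg (a * c) / 4).
  by rewrite -H; ring.
by field; rewrite a0 c0 q0 D.
Qed.

(** * The sums in rho through Rademacher's function *)

Definition sawtooth_sum (g : 'M[rat]_2) (r : rat) : rat :=
  \sum_(y \in QZ_kernel (check g)) \sum_(0 <= j < `|denq r|)
    periodic_B1 ((y 0 0 + j%:R) / `|denq r|%:R) *
    periodic_B1 ((numq r)%:~R * (y 0 0 + j%:R) / `|denq r|%:R + y 0 1).

Lemma sum_B2_upper (a d : nat) (b : int) : (0 < a)%N -> (0 < d)%N ->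
  sum_B2 (check (mx2 a%:R b%:~R 0 d%:R)) = a%:R / d%:R / 6.
Proof.
move=> a0 d0; rewrite /sum_B2 (@sum_QZ_kernel_upper _ _ _ _ (fun x _ => periodic_B2 x)) //.
under eq_bigr do rewrite sumr_const_nat subn0.
rewrite sumrMnl sum_B2_nat // -mulr_natr.
by have := natr_rat_neq0 d0; move=> d0'; field.
Qed.

(** Above each y_1 = k/d, the distribution relation sums out the a values of y_2. The indices k and
    j then merge into j d + k, which runs below d times the denominator of r, a common denominator
    for the Dedekind sum on the right. *)
Lemma sawtooth_sum_upper (a d : nat) (b : int) (r : rat) : (0 < a)%N -> (0 < d)%N ->
  sawtooth_sum (mx2 a%:R b%:~R 0 d%:R) r = dedekind ((a%:R * r + b%:~R) / d%:R).
Proof.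
move=> a0 d0; have a0' := natr_rat_neq0 a0; have d0' := natr_rat_neq0 d0.
have q0' := natr_rat_neq0 (absz_denq_gt0 r).
have rq : r * `|denq r|%:R = (numq r)%:~R by rewrite natr_absz_denq -numqE.
rewrite -(@dsum_dedekind (`|denq r| * d)); first last.
- have -> : (a%:R * r + b%:~R) / d%:R * (`|denq r| * d)%:R =
      a%:R * (numq r)%:~R + b%:~R * `|denq r|%:R by rewrite natrM -rq; field.
  by rewrite rpredD ?rpredM ?intr_int ?natr_int.
- by rewrite muln_gt0 absz_denq_gt0.
rewrite /dsum big_nat_mul_split exchange_big.
rewrite /sawtooth_sum (@sum_QZ_kernel_upper _ _ _ _ (fun x y =>
  \sum_(0 <= j < `|denq r|) periodic_B1 ((x + j%:R) / `|denq r|%:R) *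
    periodic_B1 ((numq r)%:~R * (x + j%:R) / `|denq r|%:R + y))) //; last first.
  move=> x y z yz; apply: eq_bigr => j _; congr (_ * _).
  by rewrite -[y](subrK z) [y - z + z]addrC addrA periodic_B1Dz.
apply: eq_bigr => k _; rewrite exchange_big; apply: eq_bigr => j _.
rewrite -mulr_sumr; congr (periodic_B1 _ * _).
  by rewrite natrD !natrM; field; rewrite d0' q0'.
transitivity (\sum_(0 <= l < a) periodic_B1
    ((a%:R * r * (k%:R / d%:R + j%:R) + b%:~R * (k%:R / d%:R) + l%:R) / a%:R)).
  by apply: eq_bigr => l _; congr periodic_B1; rewrite -rq; field; rewrite a0' d0' q0'.
(* The two arguments differ by the integer b j. *)
rewrite periodic_B1_distr // -[RHS](@periodic_B1Dz _ (b * - j%:Z)%:~R) ?intr_int //.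
by congr periodic_B1; rewrite natrD natrM intrM intrN -pmulrn; field.
Qed.

(** [check] reverses products, so the unimodular left factor becomes a unimodular right factor. *)
Lemma unimodular_kernel (g : 'M[rat]_2) (a b c d : int) :
  \det g != 0 -> a * d - b * c = 1 ->
  QZ_kernel (check (mx2 a%:~R b%:~R c%:~R d%:~R *m g)) = QZ_kernel (check g).
Proof.
move=> g0 D; have DQ : a%:~R * d%:~R - b%:~R * c%:~R = 1 :> rat.
  by rewrite -!intrM -intrB D.
rewrite [g]mx2_eta mulmx2; move: g0; rewrite {1}[g]mx2_eta det2.
move: (g 0 0) (g 0 1) (g 1 0) (g 1 1) => x y z t g0.
have E : (a%:~R * x + b%:~R * z) * (c%:~R * y + d%:~R * t) -
      (a%:~R * y + b%:~R * t) * (c%:~R * x + d%:~R * z) = x * t - y * z.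
  by rewrite -[RHS]mul1r -[1 in RHS]DQ; ring.
rewrite !check_mx2 ?E //.
rewrite -(@QZ_kernel_mulr (mx2 t (- y) (- z) x) (mx2 d%:~R (- b%:~R) (- c%:~R) a%:~R)
  (mx2 a%:~R b%:~R c%:~R d%:~R)).
- by rewrite mulmx2; congr QZ_kernel; congr mx2; ring.
- by elim/ord2_ind; elim/ord2_ind; rewrite mxE /= ?rpredN intr_int.
- by elim/ord2_ind; elim/ord2_ind; rewrite mxE /= intr_int.
rewrite (_ : 1%:M = mx2 1 0 0 1) ?mulmx2.
  by congr mx2; try ring; rewrite -[RHS]DQ; ring.
by apply/matrixP; elim/ord2_ind; elim/ord2_ind; rewrite !mxE.
Qed.

Lemma sum_B2_unimodular (g : 'M[rat]_2) (a b c d : int) :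
  \det g != 0 -> a * d - b * c = 1 ->
  sum_B2 (check (mx2 a%:~R b%:~R c%:~R d%:~R *m g)) = sum_B2 (check g).
Proof. by move=> g0 D; rewrite /sum_B2 unimodular_kernel. Qed.

Lemma sawtooth_sum_unimodular (g : 'M[rat]_2) (r : rat) (a b c d : int) :
  \det g != 0 -> a * d - b * c = 1 ->
  sawtooth_sum (mx2 a%:~R b%:~R c%:~R d%:~R *m g) r = sawtooth_sum g r.
Proof. by move=> g0 D; rewrite /sawtooth_sum unimodular_kernel. Qed.

Lemma translation_mx2 (a b c d : rat) (m : int) :
  mx2 (a + m%:~R * c) (b + m%:~R * d) c d =
  mx2 1%:~R m%:~R 0%:~R 1%:~R *m mx2 a b c d.
Proof. by rewrite mulmx2; congr mx2; ring. Qed.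

Lemma inversion_mx2 (a b c d : rat) :
  mx2 (- c) (- d) a b = mx2 0%:~R (-1)%:~R 1%:~R 0%:~R *m mx2 a b c d.
Proof. by rewrite mulmx2; congr mx2; ring. Qed.

Lemma det_rat_neq0 (a b c d : int) : 0 < a * d - b * c ->
  (a%:~R * d%:~R - b%:~R * c%:~R : rat) != 0.
Proof. by move=> D; rewrite -!intrM -intrB intr_eq0 gt_eqF. Qed.

(** Both sides are invariant under SL(2, Z) on the left, and for an upper triangular matrix both are
    a/(6 d). *)
Lemma sum_B2_content (a b c d : int) : 0 < a * d - b * c ->
  sum_B2 (check (mx2 a%:~R b%:~R c%:~R d%:~R)) =
  content_ratio a%:~R b%:~R c%:~R d%:~R / 6.
Proof.
elim/euclid_ind => {a b c d} [a d b a0 d0|a b c d m D IH|a b c d D IH].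
- by rewrite sum_B2_upper // /content_ratio eqxx.
- rewrite !intrD !intrM content_ratioT -IH translation_mx2 sum_B2_unimodular //.
    by rewrite det2 det_rat_neq0.
  by rewrite mulr0 subr0.
rewrite !intrN inversion_mx2 sum_B2_unimodular ?det2 ?det_rat_neq0 //.
by rewrite content_ratioS ?det_rat_neq0.
Qed.

(** Here (a, c) and (a', c') stand for the first columns of g1 and g1 g2, whose determinant is
    det(g1) c2 > 0. The identity says that, under inversion, the jumps of the two Rademacher values
    balance the change of sign(c1 c2 c12). *)
Lemma sgr_inversion (a c a' c' : rat) : 0 < a * c' - c * a' ->
  Num.sg (a' * c') + Num.sg (c * c') = Num.sg (a * c) + Num.sg (a * a').
Proof.
rewrite !sgrM.
by case: (sgrP a) => ha; case: (sgrP c) => hc; case: (sgrP a') => ha';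
  case: (sgrP c') => hc' //=; nra.
Qed.

(** For fixed g2, this is Euclidean induction on g1. The left side is invariant under SL(2, Z). On
    the right, a translation adds m/12 to both Rademacher values, which are subtracted, and
    inversion is handled by [sgr_inversion]. For upper triangular g1 the sign term is 0 and both
    sides reduce to the Dedekind sum in the value at g1 g2. *)
Lemma sawtooth_sum_rademacher (a b c d a2 b2 c2 d2 : int) :
  0 < a * d - b * c -> 0 < a2 * d2 - b2 * c2 -> 0 < c2 ->
  let g1 := mx2 a%:~R b%:~R c%:~R d%:~R : 'M[rat]_2 in
  let g2 := mx2 a2%:~R b2%:~R c2%:~R d2%:~R : 'M[rat]_2 in
  let g := g1 *m g2 in
  sawtooth_sum g1 (a2%:~R / c2%:~R) =
  (a2%:~R / c2%:~R * content_ratio a%:~R b%:~R c%:~R d%:~R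
   + d2%:~R / c2%:~R * content_ratio (g 0 0) (g 0 1) (g 1 0) (g 1 1)) / 12
  + rademacher a%:~R b%:~R c%:~R d%:~R
  - rademacher (g 0 0) (g 0 1) (g 1 0) (g 1 1)
  - Num.sg (c%:~R * c2%:~R * g 1 0) / 4.
Proof.
move=> D D2 c20 g1 g2 g; rewrite {}/g {}/g1 {}/g2 mulmx2 !mxE /=.
set A := a2%:~R; set B := b2%:~R; set C := c2%:~R; set E := d2%:~R.
have C0 : 0 < C by rewrite ltr0z.
have C0' : C != 0 by rewrite gt_eqF.
have DQ : 0 < A * E - B * C by rewrite -!intrM -intrB ltr0z.
move: a b c d D; apply: euclid_ind => [a d b a0 d0|a b c d m D IH|a b c d D IH].
- have a0' := natr_rat_neq0 a0; have d0' := natr_rat_neq0 d0.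
  have dC : d%:R * C != 0 by rewrite mulf_neq0.
  rewrite -!pmulrn sawtooth_sum_upper //.
  rewrite (mul0r A) (mul0r B) (mul0r C) (mul0r (_ + _)) !add0r sgr0 (mul0r 4^-1).
  set K := content_ratio _ _ (d%:R * C) _; rewrite /rademacher -/K eqxx (negPf dC).
  rewrite /content_ratio eqxx.
  have -> : (a%:R * (A / C) + b%:~R) / d%:R = (a%:R * A + b%:~R * C) / (d%:R * C).
    by field; rewrite d0' C0'.
  by field; rewrite d0' C0'.
- have E12 (x y : rat) : (a%:~R + m%:~R * c%:~R) * x + (b%:~R + m%:~R * d%:~R) * y
      = a%:~R * x + b%:~R * y + m%:~R * (c%:~R * x + d%:~R * y) by ring.
  rewrite !intrD !intrM !E12 !content_ratioT rademacherT ?det_rat_neq0 //.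
  rewrite rademacherT; last first.
    by rewrite -!det2 -mulmx2 det_mulmx !det2 mulf_neq0 ?det_rat_neq0 // gt_eqF.
  rewrite translation_mx2 sawtooth_sum_unimodular ?IH ?det2 ?det_rat_neq0 //; last by lia.
  by ring.
have D' := det_rat_neq0 D.
have D'' : (a%:~R * A + b%:~R * C) * (c%:~R * B + d%:~R * E) -
    (a%:~R * B + b%:~R * E) * (c%:~R * A + d%:~R * C) != 0.
  by rewrite -!det2 -mulmx2 det_mulmx !det2 mulf_neq0 // gt_eqF.
have N12 (x y z t : rat) : - x * y + - z * t = - (x * y + z * t) by ring.
rewrite !intrN inversion_mx2 sawtooth_sum_unimodular ?det2 //.
rewrite !N12 (content_ratioS D') (content_ratioS D'') (rademacherS D') (rademacherS D'') IH.
have := @sgr_inversion a%:~R c%:~R (a%:~R * A + b%:~R * C) (c%:~R * A + d%:~R * C).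
have -> : a%:~R * (c%:~R * A + d%:~R * C) - c%:~R * (a%:~R * A + b%:~R * C)
  = (a%:~R * d%:~R - b%:~R * c%:~R) * C by ring.
rewrite mulr_gt0 //; last by rewrite -!intrM -intrB ltr0z.
move=> /(_ isT); rewrite !(sgrM (_ * C)) !(sgrM _ C) (gtr0_sg C0) !mulr1 -!sgrM => H.
lra.
Qed.

Definition rademacher_mx (g : 'M[rat]_2) : rat :=
  rademacher (g 0 0) (g 0 1) (g 1 0) (g 1 1).

(** For c2 > 0, the content ratios of g1 and g1 g2 coming from the B_2 sums cancel those in
    [sawtooth_sum_rademacher]; what is left of the terms in g2 alone is -2 u(g2). *)
Lemma rho_rademacher (M1 M2 : 'M[int]_2) :
  0 < \det M1 -> 0 < \det M2 -> 0 <= M2 1 0 ->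
  let g1 : 'M[rat]_2 := map_mx intr M1 in
  let g2 : 'M[rat]_2 := map_mx intr M2 in
  rho M1 M2 =
  - 2 * (rademacher_mx g2 - rademacher_mx (g1 *m g2) + rademacher_mx g1)
  + Num.sg (g1 1 0 * g2 1 0 * (g1 *m g2) 1 0) / 2.
Proof.
rewrite [M1]mx2_eta [M2]mx2_eta.
move: (M1 0 0) (M1 0 1) (M1 1 0) (M1 1 1) (M2 0 0) (M2 0 1) (M2 1 0) (M2 1 1).
move=> a b c d a2 b2 c2 d2; rewrite !det2 mxE /= => D D2 c20.
rewrite /rho !map_mx2.
have D' := det_rat_neq0 D; have D2' := det_rat_neq0 D2.
have Dm : 0 < (a * a2 + b * c2) * (c * b2 + d * d2) - (a * b2 + b * d2) * (c * a2 + d * c2).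
  by rewrite -!det2 -mulmx2 det_mulmx !det2 mulr_gt0.
have Dm' := det_rat_neq0 Dm.
rewrite sum_B2_content // mulmx2 !mxE /= /rademacher_mx !mxE /=.
have [c2E|c2N] := eqVneq (c2%:~R : rat) 0.
  move: (c2E) => /eqP; rewrite intr_eq0 => /eqP c2E'.
  rewrite c2E !mulr0 mul0r sgr0 mul0r addr0 !addr0.
  have a20 : (a2%:~R : rat) != 0 by apply: contraNneq D2' => ->; rewrite c2E mulr0 mul0r subrr.
  have d20 : (d2%:~R : rat) != 0 by apply: contraNneq D2' => ->; rewrite c2E !mulr0 subrr.
  rewrite {1}/rademacher eqxx.
  have [cE|cN] := eqVneq (c%:~R : rat) 0.
    have a10 : (a%:~R : rat) != 0 by apply: contraNneq D' => ->; rewrite cE mulr0 mul0r subrr.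
    have d10 : (d%:~R : rat) != 0 by apply: contraNneq D' => ->; rewrite cE !mulr0 subrr.
    rewrite cE !mul0r add0r /rademacher /content_ratio !eqxx.
    by field; rewrite d10 d20.
  rewrite /rademacher /content_ratio (negPf cN) mulf_eq0 (negPf cN) (negPf a20) /=.
  have -> : a%:~R * a2%:~R / (c%:~R * a2%:~R) = a%:~R / c%:~R :> rat by field; rewrite cN a20.
  have q0 : ((denq (a%:~R / c%:~R))%:~R : rat) != 0 by rewrite intr_eq0 denq_neq0.
  set X := dedekind _.
  have -> : a%:~R * a2%:~R * (c%:~R * b2%:~R + d%:~R * d2%:~R) -
      (a%:~R * b2%:~R + b%:~R * d2%:~R) * (c%:~R * a2%:~R) =
      (a%:~R * d%:~R - b%:~R * c%:~R) * (a2%:~R * d2%:~R) :> rat by ring.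
  by field; rewrite D' a20 d20 cN q0.
have c2p : 0 < c2 by rewrite lt_def c20 andbT -(intr_eq0 rat).
have -> : check (mx2 a2%:~R b2%:~R c2%:~R d2%:~R) *m check (mx2 a%:~R b%:~R c%:~R d%:~R)
    = check (mx2 (a * a2 + b * c2)%:~R (a * b2 + b * d2)%:~R
                 (c * a2 + d * c2)%:~R (c * b2 + d * d2)%:~R).
  by rewrite !check_mx2 // mulmx2; congr mx2; rewrite !(intrD, intrM); ring.
rewrite !sum_B2_content //.
set r := a2%:~R / c2%:~R.
set S := (X in _ - 2 * X + _); have -> : S = sawtooth_sum (mx2 a%:~R b%:~R c%:~R d%:~R) r by [].
have := sawtooth_sum_rademacher D D2 c2p; rewrite /= mulmx2 !mxE /= => ->.
set T := (X in _ + 2 * X = _); have -> : T = dedekind r.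
  apply: eq_bigr => j _; congr (_ * periodic_B1 _).
  by rewrite mulrAC natr_absz_denq divq_num_den.
rewrite -!intrM -!intrD; set g := rademacher (a * a2 + _)%:~R _ _ _.
by rewrite [rademacher a2%:~R _ _ _]/rademacher (negPf c2N) -/r; field.
Qed.

(** * The sign cocycle *)

Lemma sgr_add (F : realDomainType) (p q : F) :
  Num.sg (p * q * (p + q)) + Num.sg (p + q) = Num.sg p + Num.sg q.
Proof.
rewrite !sgrM; case: (sgrP p) => [->|hp|hp].
- by rewrite !mul0r !add0r.
- case: (sgrP q) => [->|hq|hq]; rewrite ?mulr0 ?mul0r ?addr0 ?add0r ?(gtr0_sg hp) //.
    by rewrite gtr0_sg ?addr_gt0 // !mul1r.
  by rewrite mul1r mulN1r addNr subrr.
case: (sgrP q) => [->|hq|hq]; rewrite ?mulr0 ?mul0r ?addr0 ?add0r ?(ltr0_sg hp) //.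
  by rewrite mulr1 mulN1r !addNr.
have pq : p + q < 0 by lra.
by rewrite (ltr0_sg pq) !mulN1r opprK mul1r.
Qed.

(* The orientation of triples of points of the projective line, here          *)
(* [1 : 0], [a : x], [b : y], [e : z], is a cocycle.                          *)
Lemma sgr_orientation_cocycle (F : realFieldType) (a x b y e z : F) :
  (x = 0 -> a != 0) -> (y = 0 -> b != 0) -> (z = 0 -> e != 0) ->
  let p := a * y - x * b in let q := b * z - y * e in let s := a * z - x * e in
  Num.sg (p * q * s) + Num.sg (x * s * z) = Num.sg (y * q * z) + Num.sg (x * p * y).
Proof.
move=> xa yb ze p q s.
have sq (t u : F) : t != 0 -> Num.sg (t ^+ 2 * u) = Num.sg u.
  by move=> t0; rewrite sgrM gtr0_sg ?mul1r // exprn_even_gt0.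
have [x0|x0] := eqVneq x 0.
  rewrite x0 !mul0r sgr0 !addr0 -[RHS](sq _ _ (xa x0)); congr Num.sg.
  by rewrite /p /q /s x0; ring.
have [y0|y0] := eqVneq y 0.
  have -> : p * q * s = - (b ^+ 2 * (x * s * z)) by rewrite /p /q /s y0; ring.
  by rewrite sgrN sq ?yb // addNr y0 !(mulr0, mul0r) sgr0 addr0.
have [z0|z0] := eqVneq z 0.
  rewrite z0 !mulr0 sgr0 addr0 add0r -[RHS](sq _ _ (ze z0)); congr Num.sg.
  by rewrite /p /q /s z0; ring.
have -> : Num.sg (p * q * s) = Num.sg (p / (x * y) * (q / (y * z)) * (p / (x * y) + q / (y * z))).
  rewrite -[RHS](sq (x * y * z)) ?mulf_neq0 //; congr Num.sg.
  by rewrite /p /q /s; field; rewrite x0 y0 z0.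
have -> : Num.sg (x * s * z) = Num.sg (p / (x * y) + q / (y * z)).
  rewrite -[RHS](sq (x * z)) ?mulf_neq0 //; congr Num.sg.
  by rewrite /p /q /s; field; rewrite x0 y0 z0.
have -> : Num.sg (y * q * z) = Num.sg (q / (y * z)).
  rewrite -[RHS](sq (y * z)) ?mulf_neq0 //; congr Num.sg.
  by rewrite /q; field; rewrite y0 z0.
have -> : Num.sg (x * p * y) = Num.sg (p / (x * y)).
  rewrite -[RHS](sq (x * y)) ?mulf_neq0 //; congr Num.sg.
  by rewrite /p; field; rewrite x0 y0.
by rewrite sgr_add addrC.
Qed.

(* Minus the orientation of the triple (oo, A oo, AB oo). *)
Definition sign_cochain (F : realFieldType) (A B : 'M[F]_2) : F :=
  Num.sg (A 1 0 * B 1 0 * (A *m B) 1 0).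

Lemma sign_cochain_opp (F : realFieldType) (A B : 'M[F]_2) :
  sign_cochain (- A) B = sign_cochain A B /\ sign_cochain A (- B) = sign_cochain A B.
Proof.
rewrite /sign_cochain mulNmx mulmxN !mxE.
by split; congr Num.sg; ring.
Qed.

(** The identity for the four points oo, A oo, AB oo, ABC oo. Since det M = 1, the determinant of
    the first columns of M and M N is the lower left entry of N. *)
Lemma sign_cocycle (F : realFieldType) (A B C : 'M[F]_2) :
  \det A = 1 -> \det B = 1 -> \det C = 1 ->
  sign_cochain B C + sign_cochain A (B *m C) =
  sign_cochain (A *m B) C + sign_cochain A B.
Proof.
have col (M : 'M[F]_2) : \det M = 1 -> M 1 0 = 0 -> M 0 0 != 0.
  rewrite {1}[M]mx2_eta det2 => D c0; apply: contra_eq_neq D => ->.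
  by rewrite c0 mul0r mulr0 subr0 eq_sym oner_eq0.
move=> DA DB DC; have DAB : \det (A *m B) = 1 by rewrite det_mulmx DA DB mulr1.
have DABC : \det (A *m B *m C) = 1 by rewrite det_mulmx DAB DC mulr1.
have := sgr_orientation_cocycle (col _ DA) (col _ DAB) (col _ DABC) => /=.
have move2 (M N : 'M[F]_2) : \det M = 1 ->
    M 0 0 * (M *m N) 1 0 - M 1 0 * (M *m N) 0 0 = N 1 0.
  rewrite {1}[M]mx2_eta det2 => D; rewrite !mulmx2E.
  by rewrite -[RHS]mul1r -D; ring.
rewrite (move2 _ _ DA) (move2 _ _ DAB).
have := move2 _ (B *m C) DA; rewrite mulmxA => -> E.
by rewrite /sign_cochain mulmxA.
Qed.

(** * Passage to PSL(2, Q) *)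

Lemma rademacher_mxZ (t : rat) (g : 'M[rat]_2) : t != 0 -> \det g != 0 ->
  rademacher_mx (t *: g) = rademacher_mx g.
Proof.
move=> t0; rewrite {1}[g]mx2_eta det2 /rademacher_mx !mxE.
move: (g 0 0) (g 0 1) (g 1 0) (g 1 1) => a b c d D.
rewrite /rademacher /content_ratio mulf_eq0 (negPf t0) /=.
case: (eqVneq c 0) D => [->|c0] D.
  have d0 : d != 0 by apply: contraNneq D => ->; rewrite !mulr0 subrr.
  by field; rewrite t0 d0.
have -> : t * a / (t * c) = a / c by field; rewrite t0 c0.
have q0 : ((denq (a / c))%:~R : rat) != 0 by rewrite intr_eq0 denq_neq0.
have -> : t * a * (t * d) - t * b * (t * c) = t ^+ 2 * (a * d - b * c) by ring.
by move: (dedekind _) (_%:~R) q0 => X Q q0; field; rewrite D q0 c0 t0.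
Qed.

Lemma repr_PSL2_mul (F : fieldType) (p q : PSL2 F) :
  exists2 s : F, s = 1 \/ s = -1 &
    (repr (p * q)%g : 'M[F]_2) = s *: (repr p *m repr q).
Proof.
have [->|->] := PSL2_reprP (repr p * repr q)%g.
  by exists 1; [left|rewrite scale1r].
by exists (-1); [right|rewrite scaleN1r].
Qed.

Lemma det_repr (F : fieldType) (p : PSL2 F) : \det (repr p : 'M[F]_2) = 1.
Proof. exact/eqP/det_SL2. Qed.

Lemma sign_cochain_sign (F : realFieldType) (s : F) (A B : 'M[F]_2) :
  s = 1 \/ s = -1 ->
  sign_cochain (s *: A) B = sign_cochain A B /\
  sign_cochain A (s *: B) = sign_cochain A B.
Proof.
case=> ->; first by rewrite !scale1r.
by rewrite !scaleN1r; apply: sign_cochain_opp.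
Qed.

Lemma rademacher_repr_mul (p q : PSL2 rat) :
  rademacher_mx (repr (p * q)%g) = rademacher_mx (repr p *m repr q).
Proof.
have [s s1 ->] := repr_PSL2_mul p q; rewrite rademacher_mxZ //.
  by case: s1 => ->; rewrite ?oppr_eq0 oner_eq0.
by rewrite det_mulmx !det_repr mulr1 oner_eq0.
Qed.

(** Defined by the closed formula on determinant 1 representatives, so that no choice of integral
    matrices enters; [rho_cochainE] identifies it with [rho]. *)
Definition rho_cochain (p q : PSL2 rat) : rat :=
  - 2 * coboundary1 (fun p : PSL2 rat => rademacher_mx (repr p)) p q
  + sign_cochain (repr p : 'M[rat]_2) (repr q) / 2.

Lemma rho_cochainE (p q : PSL2 rat) (M1 M2 : 'M[int]_2) :
  integral_representative M1 p -> integral_representative M2 q ->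
  0 <= M2 1 0 -> rho_cochain p q = rho M1 M2.
Proof.
move=> [D1 [t1 E1]] [D2 [t2 E2]] c20; rewrite rho_rademacher // E1 E2.
have nz (M : 'M[int]_2) t (g : PSL2 rat) : 0 < \det M ->
    map_mx intr M = t *: (repr g : 'M[rat]_2) -> t != 0.
  move=> D E; have : \det (map_mx intr M : 'M[rat]_2) != 0.
    by rewrite det_map_mx intr_eq0 gt_eqF.
  by apply: contraNneq => t0; rewrite E t0 scale0r det0.
have t10 := nz _ _ _ D1 E1; have t20 := nz _ _ _ D2 E2.
have one : (1 : rat) != 0 := oner_neq0 _.
rewrite -scalemxAl -scalemxAr scalerA !rademacher_mxZ ?mulf_neq0 ?det_mulmx ?det_repr ?mulr1 //.
rewrite /rho_cochain /coboundary1 rademacher_repr_mul; congr (_ + _ / 2).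
rewrite /sign_cochain !mxE -[LHS]mul1r.
(* Rescaling the representatives by t1 and t2 multiplies c1 c2 c12 by (t1 t2)^2. *)
have <- : Num.sg ((t1 * t2) ^+ 2) = 1 by rewrite gtr0_sg // exprn_even_gt0 ?mulf_neq0.
by rewrite -sgrM; congr Num.sg; ring.
Qed.

Lemma rho_cochain_cocycle : cocycle2 rho_cochain.
Proof.
move=> p q k; rewrite /rho_cochain /coboundary1 mulgA.
have [s s1 Es] := repr_PSL2_mul p q; have [t t1 Et] := repr_PSL2_mul q k.
have := @sign_cocycle _ _ _ _ (det_repr p) (det_repr q) (det_repr k).
rewrite Es Et (sign_cochain_sign _ _ s1).1 (sign_cochain_sign _ _ t1).2.
do 4![move: (sign_cochain _ _) => ?]; do 6![move: (rademacher_mx _) => ?].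
lra.
Qed.

(** * Lifts to the universal cover *)

Lemma sin_le0_itv (R : realType) (x : R) : - pi <= x <= 0 -> sin x <= 0.
Proof.
move=> /andP[x1 x2]; rewrite -oppr_ge0 -sinN; apply: sin_ge0_pi.
by rewrite oppr_ge0 x2 lerNl.
Qed.

Lemma sin_eq0_itv (R : realType) (x : R) : 0 < x < 2 * pi -> sin x = 0 -> x = pi.
Proof.
move=> /andP[x0 x2] s0; have p0 := pi_gt0 R.
case: (ltgtP x pi) => // h; move: s0.
  by have := @sin_gt0_pi _ x; rewrite x0 h => /(_ isT); lra.
have -> : x = (x - pi) + pi by ring.
have : 0 < sin (x - pi) by apply: sin_gt0_pi; rewrite subr_gt0 h /=; lra.
by rewrite sinDpi; lra.
Qed.

Lemma sin_natpi (R : realType) (n : nat) : sin (n%:R * pi : R) = 0.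
Proof.
elim: n => [|n IH]; first by rewrite mul0r sin0.
by rewrite -natr1 mulrDl mul1r sinDpi IH oppr0.
Qed.

Lemma sin_intpi (R : realType) (n : int) : sin (n%:~R * pi : R) = 0.
Proof.
case: n => n; first exact: sin_natpi.
by rewrite NegzE intrN mulNr sinN sin_natpi oppr0.
Qed.

Lemma sinD_intpi (R : realType) (n : int) (x : R) :
  sin (x + n%:~R * pi) = sin x * cos (n%:~R * pi).
Proof. by rewrite sinD sin_intpi mulr0 addr0. Qed.

Lemma sin_triple_intpi (R : realType) (x y z : R) (m n : int) :
  sin (x + m%:~R * pi) * sin (y + n%:~R * pi) * sin (z + (m + n)%:~R * pi) =
  sin x * sin y * sin z.
Proof.
have sq (k : int) : cos (k%:~R * pi : R) ^+ 2 = 1.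
  by rewrite -[RHS](cos2Dsin2 (k%:~R * pi)) sin_intpi expr0n addr0.
rewrite !sinD_intpi intrD mulrDl cosD !sin_intpi mul0r subr0.
set e := cos (m%:~R * pi); set d := cos (n%:~R * pi).
transitivity (sin x * sin y * sin z * (e ^+ 2 * d ^+ 2)); first by ring.
by rewrite !sq !mulr1.
Qed.

Lemma continuous_IVT (R : realType) (f : R -> R) (a b v : R) :
  continuous f -> a <= b -> Num.min (f a) (f b) <= v <= Num.max (f a) (f b) ->
  exists c, a <= c <= b /\ f c = v.
Proof.
move=> cf ab fv; have [c] := IVT ab (continuous_subspaceT cf) fv.
by rewrite in_itv /= => cab fc; exists c.
Qed.

Lemma continuous_neq0_sign (R : realType) (f : R -> R) (a b : R) :
  continuous f -> (forall x, f x != 0) -> 0 < f a * f b.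
Proof.
move=> cf f0; wlog ab : a b / a <= b.
  move=> H; have [/H//|/ltW/H] := leP a b; by rewrite mulrC.
rewrite ltNge; apply/negP => fab.
have [c [_ fc]] : exists c, a <= c <= b /\ f c = 0.
  apply: continuous_IVT => //; rewrite ge_min le_max.
  by move: fab; case: (ltgtP (f a) 0) => ha; case: (ltgtP (f b) 0) => hb //; nra.
by have := f0 c; rewrite fc eqxx.
Qed.

Section Lift.
Variables (R : realType) (A : 'M[R]_2) (f : R -> R).
Hypothesis detA : \det A = 1.
Hypothesis cf : continuous f.
Hypothesis fA : forall t, exists k : R, A *m direction t = k *: direction (f t).

(** The coefficient k of [fA], recovered as the scalar product with the unit vector
    [direction (f t)]; in this form it is visibly continuous. *)
Definition lift_scale (t : R) : R :=
  (A 0 0 * cos t + A 0 1 * sin t) * cos (f t) +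
  (A 1 0 * cos t + A 1 1 * sin t) * sin (f t).

Lemma lift_scaleE (t : R) :
  A 0 0 * cos t + A 0 1 * sin t = lift_scale t * cos (f t) /\
  A 1 0 * cos t + A 1 1 * sin t = lift_scale t * sin (f t).
Proof.
have [k E] := fA t.
have E0 : A 0 0 * cos t + A 0 1 * sin t = k * cos (f t).
  by have := congr1 (fun M : 'cV[R]_2 => M 0 0) E; rewrite mulmx2E !mxE.
have E1 : A 1 0 * cos t + A 1 1 * sin t = k * sin (f t).
  by have := congr1 (fun M : 'cV[R]_2 => M 1 0) E; rewrite mulmx2E !mxE.
have -> : lift_scale t = k.
  rewrite /lift_scale E0 E1 -[RHS]mulr1 -(cos2Dsin2 (f t)); ring.
by [].
Qed.

(** A preserves the determinant of the pair of vectors [direction t], [direction u], which is sin (u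
    - t). *)
Lemma lift_wedge (t u : R) :
  sin (u - t) = lift_scale t * lift_scale u * sin (f u - f t).
Proof.
have [t0 t1] := lift_scaleE t; have [u0 u1] := lift_scaleE u.
have -> : lift_scale t * lift_scale u * sin (f u - f t) =
    (lift_scale t * cos (f t)) * (lift_scale u * sin (f u)) -
    (lift_scale t * sin (f t)) * (lift_scale u * cos (f u)).
  by rewrite sinB; ring.
rewrite -t0 -t1 -u0 -u1 sinB.
have D : A 0 0 * A 1 1 - A 0 1 * A 1 0 = 1 by rewrite -detA {5}[A]mx2_eta det2.
by rewrite -[LHS]mul1r -D; ring.
Qed.

(** By [lift_wedge] at x and x + pi/2, the scale never vanishes; being continuous, it keeps its
    sign. *)
Lemma lift_scale_sign (t u : R) : 0 < lift_scale t * lift_scale u.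
Proof.
apply: continuous_neq0_sign => [x|x].
  have cC (h : R -> R) : continuous h -> {for x, continuous (fun y => cos (h y))}.
    by move=> ch; apply: continuous_comp; [exact: ch|exact: continuous_cos].
  have cS (h : R -> R) : continuous h -> {for x, continuous (fun y => sin (h y))}.
    by move=> ch; apply: continuous_comp; [exact: ch|exact: continuous_sin].
  have cid : continuous (@id R) by move=> y; exact: cvg_id.
  by apply: cvgD; apply: cvgM; [apply: cvgD; apply: cvgM; try exact: cvg_cst| |
     apply: cvgD; apply: cvgM; try exact: cvg_cst|]; first [exact: (cC _ cid)|
     exact: (cS _ cid)|exact: (cC _ cf)|exact: (cS _ cf)].
have := lift_wedge x (x + pi / 2).
rewrite [x + _]addrC addrK sin_pihalf => /eqP; apply: contraTneq => ->.
by rewrite !mul0r oner_eq0.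
Qed.

(** On (t, t + pi) the sine of f s - f t is positive, and the difference starts from 0 at s = t. By
    continuity it can cross neither pi nor -pi, and a value in [-pi, 0] would have sine at most
    0. *)
Lemma lift_increasing (t u : R) : t < u < t + pi -> 0 < f u - f t < pi.
Proof.
move=> /andP[tu ut]; have p0 := pi_gt0 R.
have pos (s : R) : t < s < t + pi -> 0 < sin (f s - f t).
  move=> s1; rewrite -(pmulr_rgt0 _ (lift_scale_sign t s)) -lift_wedge.
  by apply: sin_gt0_pi; lra.
pose g (s : R) := f s - f t.
have cg : continuous g by move=> s; apply: cvgB; [exact: cf|exact: cvg_cst].
have g0 : g t = 0 by rewrite /g subrr.
have hit (v : R) : sin v <= 0 -> v != 0 -> ~ (Num.min 0 (g u) <= v <= Num.max 0 (g u)).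
  move=> sv v0; rewrite -g0 => /(continuous_IVT cg (ltW tu))[c [/andP[tc cu] gc]].
  have ct : t < c by rewrite lt_neqAle tc andbT; apply: contraNneq v0 => tcE; rewrite -gc -tcE g0.
  have := pos c; rewrite ct (le_lt_trans cu ut) -/(g c) gc => /(_ isT).
  by rewrite ltNge sv.
apply/andP; split; rewrite ltNge; apply/negP => h.
  have [h1|h1] := leP (- pi) (g u).
    have := pos u; rewrite tu ut => /(_ isT); rewrite ltNge sin_le0_itv //.
    by rewrite h1.
  apply: (hit (- pi)); rewrite ?sinN ?sinpi ?oppr0 ?oppr_eq0 ?gt_eqF //.
  by rewrite ge_min le_max (ltW h1) orbT /= oppr_le0 (ltW p0).
apply: (hit pi); rewrite ?sinpi ?gt_eqF //.
by rewrite ge_min le_max (ltW p0) /= h orbT.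
Qed.

(** The increment has sine 0 by [lift_wedge], and two steps of pi/2 place it strictly between 0 and
    2 pi. *)
Lemma lift_pi (t : R) : f (t + pi) = f t + pi.
Proof.
have p0 := pi_gt0 R.
have h1 : 0 < f (t + pi / 2) - f t < pi by apply: lift_increasing; lra.
have h2 : 0 < f (t + pi) - f (t + pi / 2) < pi by apply: lift_increasing; lra.
have : f (t + pi) - f t = pi.
  apply: sin_eq0_itv; first by move: h1 h2; lra.
  have := lift_wedge t (t + pi); rewrite [t + pi]addrC addrK sinpi => /esym/eqP.
  by rewrite mulf_eq0 gt_eqF ?lift_scale_sign //= => /eqP.
by move=> E; rewrite -[LHS](subrK (f t)) E addrC.
Qed.

Lemma lift_intpi (t : R) (n : int) : f (t + n%:~R * pi) = f t + n%:~R * pi.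
Proof.
have aux (k : nat) (s : R) : f (s + k%:R * pi) = f s + k%:R * pi.
  elim: k s => [|k IH] s; first by rewrite mul0r !addr0.
  by rewrite -natr1 mulrDl mul1r (addrA s) lift_pi IH -addrA.
case: n => n; first exact: aux.
rewrite NegzE intrN mulNr.
by have := aux n.+1 (t - n.+1%:R * pi); rewrite subrK -pmulrn => ->; rewrite addrK.
Qed.

End Lift.

(** This is floor(t/pi) + ceiling(t/pi): even at the multiples of pi, odd between them. *)
Definition half_turns (R : realType) (t : R) : int :=
  2 * Num.floor (t / pi) + (sin t != 0)%:R.

Lemma half_turnsE (R : realType) (x : R) (n : int) : 0 <= x < pi ->
  half_turns (x + n%:~R * pi) = 2 * n + (x != 0)%:R.
Proof.
move=> x01; have p0 := pi_gt0 R.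
have p0' : (pi : R) != 0 by rewrite gt_eqF.
have -> : half_turns (x + n%:~R * pi) = 2 * n + (sin (x + n%:~R * pi) != 0)%:R.
  congr (2 * _ + _); apply: floor_def; rewrite mulrDl mulfK // intrD.
  have : 0 <= x / pi < 1.
    by rewrite divr_ge0 ?(ltW p0) ?ltr_pdivrMr ?mul1r //; case/andP: x01.
  lra.
congr (_ + (~~ _)%:R); rewrite sinD_intpi mulf_eq0.
have -> : (cos (n%:~R * pi : R) == 0) = false.
  apply/negbTE; apply/eqP => c0; have := cos2Dsin2 (n%:~R * pi : R).
  by rewrite c0 sin_intpi expr0n addr0 => /eqP; rewrite eq_sym oner_eq0.
rewrite orbF; have [->|x0] := eqVneq x 0; first by rewrite sin0 eqxx.
by rewrite gt_eqF // sin_gt0_pi // lt_def x0.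
Qed.

Lemma modpi_ind (R : realType) (P : R -> Prop) :
  (forall (x : R) (n : int), 0 <= x < pi -> P (x + n%:~R * pi)) -> forall x, P x.
Proof.
move=> H x; have p0 := pi_gt0 R; have p0' : (pi : R) != 0 by rewrite gt_eqF.
rewrite -[x](subrK ((Num.floor (x / pi))%:~R * pi)); apply: H.
have := floor_itv (x / pi); rewrite ler_pdivlMr // ltr_pdivrMr // intrD mulrDl mul1r.
lra.
Qed.

(** Modulo pi, the lifts of g1, g2 and g1 g2 send 0 to a, b and e, while g is the increment of the
    lift of g1 from 0 to b. As a + g lies in [0, 2 pi), the carry m is 0 or 1, and the sign of sin
    (a + g) tells which, with e = 0 as the boundary case. *)
Lemma half_turns_add (R : realType) (a b g e : R) (m : int) :
  0 <= a < pi -> 0 <= b < pi -> 0 <= e < pi ->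
  (b = 0 -> g = 0) -> (b != 0 -> 0 < g < pi) ->
  a + g = e + m%:~R * pi ->
  ((2 * m - (a != 0)%:R - (b != 0)%:R + (e != 0)%:R)%:~R : R) =
  - Num.sg (sin a * sin b * sin (a + g)).
Proof.
move=> a01 b01 e01 gb0 gb E; have p0 := pi_gt0 R.
have m01 : m = 0 \/ m = 1.
  have h1 : (-1)%:~R * pi < (m%:~R * pi : R).
    have [/gb0|/gb] := eqVneq b 0; rewrite intrN; lra.
  have h2 : m%:~R * pi < (2%:~R * pi : R).
    have [/gb0|/gb] := eqVneq b 0; lra.
  by move: h1 h2; rewrite !ltr_pM2r // !ltr_int; lia.
have sinp (x : R) : 0 < x < pi -> 0 < sin x := @sin_gt0_pi _ x.
have [b0|b0] := eqVneq b 0.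
  move: E; rewrite (gb0 b0) b0 sin0 mulr0 mul0r sgr0 oppr0 addr0.
  case: m01 => ->; rewrite ?mul0r ?mul1r => E; last by exfalso; lra.
  by rewrite !addr0 in E; rewrite E /= subr0 mulr0 sub0r addNr oppr0.
have g01 := gb b0.
have [a0|a0] := eqVneq a 0.
  move: E; rewrite a0 sin0 !mul0r sgr0 oppr0 add0r.
  case: m01 => ->; rewrite ?mul0r ?mul1r => E; last by exfalso; lra.
  have -> : e != 0 by apply/eqP; lra.
  by rewrite /= mulr0 subr0 sub0r addNr ?oppr0.
have a01' : 0 < a < pi by rewrite lt_def a0.
have b01' : 0 < b < pi by rewrite lt_def b0.
rewrite sgrM gtr0_sg ?mulr_gt0 ?sinp // mul1r E.
case: m01 E => -> E.
  rewrite mul0r addr0 in E *.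
  have e0 : 0 < e < pi by lra.
  have -> : e != 0 by apply/eqP; lra.
  by rewrite gtr0_sg ?sinp.
rewrite mul1r sinDpi sgrN opprK.
have [e0|e0] := eqVneq e 0; first by rewrite e0 sin0 sgr0.
have e0' : 0 < e < pi by rewrite lt_def e0.
by rewrite gtr0_sg ?sinp.
Qed.

(** nu(p) counts the half turns made by the chosen lift of p at the angle 0. The lower left entry of
    a matrix is the sine of that angle times the scale of the lift, so the sign cochain only sees
    the angles. *)
Lemma universal_cover_sign (R : realType) (E : PSL2 R -> PSL2 R -> int) :
  universal_cover_cocycle E ->
  exists nu : PSL2 R -> int, forall p q,
    ((2 * E p q)%:~R : R) =
    (coboundary1 nu p q)%:~R - sign_cochain (repr p : 'M[R]_2) (repr q).
Proof.
move=> [s [sP sE]]; exists (fun p => half_turns (s p 0)) => p q.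
have p0 := pi_gt0 R; have p0' : (pi : R) != 0 by rewrite gt_eqF.
pose A : 'M[R]_2 := repr p; pose B : 'M[R]_2 := repr q.
have [cp pA] := sP p; have [cq qB] := sP q.
have DA : \det A = 1 := det_repr p; have DB : \det B = 1 := det_repr q.
pose th := s p 0; pose ph := s q 0.
have cA : A 1 0 = lift_scale A (s p) 0 * sin th.
  by have [_ <-] := lift_scaleE pA 0; rewrite cos0 sin0 mulr1 mulr0 addr0.
have cB : B 1 0 = lift_scale B (s q) 0 * sin ph.
  by have [_ <-] := lift_scaleE qB 0; rewrite cos0 sin0 mulr1 mulr0 addr0.
have aB : B 0 0 = lift_scale B (s q) 0 * cos ph.
  by have [<- _] := lift_scaleE qB 0; rewrite cos0 sin0 mulr1 mulr0 addr0.
have cAB : (A *m B) 1 0 = lift_scale B (s q) 0 * lift_scale A (s p) ph * sin (s p ph).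
  by rewrite mulmx2E aB cB -mulrA; have [_ <-] := lift_scaleE pA ph; ring.
have -> : sign_cochain A B = Num.sg (sin th * sin ph * sin (s p ph)).
  rewrite /sign_cochain cA cB cAB.
  set k := lift_scale A _ 0; set k' := lift_scale A _ ph; set l := lift_scale B _ _.
  (* The scales occur as a product of two values for the same matrix, positive by [lift_scale_sign],
     times a square. *)
  have -> : k * sin th * (l * sin ph) * (l * k' * sin (s p ph)) =
      (k * k') * (l * l) * (sin th * sin ph * sin (s p ph)) by ring.
  by rewrite sgrM gtr0_sg ?mul1r // mulr_gt0 // lift_scale_sign.
have := sE p q 0; rewrite -/ph /coboundary1 -/th.
move: (s (p * q)%g 0) => om.
have phE : s q 0 = ph by [].
have thE : s p 0 = th by [].
move: th ph thE phE {cA cB aB cAB} => th ph.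
elim/modpi_ind: ph => b n b01; elim/modpi_ind: th => a m a01; elim/modpi_ind: om => e l e01.
move=> thE phE; rewrite phE (lift_intpi DA cp pA); set g := s p b - s p 0.
have -> : s p b + n%:~R * pi = a + g + (m + n)%:~R * pi.
  by rewrite /g thE intrD; ring.
rewrite sin_triple_intpi !half_turnsE // => EE.
rewrite -(@half_turns_add _ a b g e (l + E p q - m - n)) //.
- by rewrite -intrD; congr (_%:~R); ring.
- by move=> b0; rewrite /g b0 subrr.
- move=> b0; apply: (lift_increasing DA cp pA).
  by rewrite add0r lt_def b0.
move: EE; rewrite -mulrzr => EE.
rewrite !(intrD, intrN) in EE *; lra.
Qed.

(** * The area cocycle *)

Section Argument.
Variable R : realType.

(** t is an argument of the nonzero number x + i y. As a relation it is additive under products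
    without any choice of branch; [is_arg_eq] recovers equality from a bound. *)
Definition is_arg (t x y : R) : Prop :=
  exists2 k : R, 0 < k & x = k * cos t /\ y = k * sin t.

Lemma is_argM (s t x y x' y' : R) : is_arg s x y -> is_arg t x' y' ->
  is_arg (s + t) (x * x' - y * y') (x * y' + y * x').
Proof.
move=> [k k0 [-> ->]] [l l0 [-> ->]]; exists (k * l); first exact: mulr_gt0.
by rewrite cosD sinD; split; ring.
Qed.

Lemma is_argN (t x y : R) : is_arg t x y -> is_arg (- t) x (- y).
Proof. by move=> [k k0 [-> ->]]; exists k => //; rewrite cosN sinN mulrN. Qed.

Lemma is_argZ (t x y r : R) : 0 < r -> is_arg t (r * x) (r * y) -> is_arg t x y.
Proof.
move=> r0 [k k0 [ex ey]]; exists (k / r); first exact: divr_gt0.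
by rewrite ![k / r * _]mulrAC -ex -ey; split; field; rewrite gt_eqF.
Qed.

Lemma is_arg_eq (s t x y : R) : is_arg s x y -> is_arg t x y ->
  `|s - t| < 2 * pi -> s = t.
Proof.
move=> [k k0 [xk yk]] [l l0 [xl yl]] st; have p0 := pi_gt0 R.
have n2 : k ^+ 2 = l ^+ 2.
  rewrite -[LHS]mulr1 -(cos2Dsin2 s) -[RHS]mulr1 -(cos2Dsin2 t) !mulrDr -!exprMn.
  by rewrite -xk -yk -xl -yl.
have kl : k = l by apply/eqP; rewrite -(eqrXn2 (n := 2)) ?ltW //; apply/eqP.
have kn0 : l != 0 by rewrite gt_eqF.
have cst : cos s = cos t by apply: (mulfI kn0); rewrite -xl xk kl.
have sst : sin s = sin t by apply: (mulfI kn0); rewrite -yl yk kl.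
have c1 : cos (s - t) = 1 by rewrite cosB cst sst -!expr2 cos2Dsin2.
(* cos (s - t) = 1 kills the sine of the half angle, which has absolute value less than pi. *)
have s0 : sin ((s - t) / 2) = 0.
  have e2 : (s - t) / 2 + (s - t) / 2 = s - t by field.
  have : cos ((s - t) / 2 + (s - t) / 2) = 1 by rewrite e2.
  rewrite cosD -!expr2; have := cos2Dsin2 ((s - t) / 2) => h1 h2.
  by apply/eqP; rewrite -sqrf_eq0; apply/eqP; lra.
move: st; rewrite ltr_norml => /andP[h1 h2].
apply/eqP; rewrite -subr_eq0; apply/eqP.
have [h|h|//] := ltgtP (s - t) 0.
  have : 0 < sin (- ((s - t) / 2)) by apply: sin_gt0_pi; lra.
  by rewrite sinN s0 oppr0 ltxx.
have : 0 < sin ((s - t) / 2) by apply: sin_gt0_pi; lra.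
by rewrite s0 ltxx.
Qed.

Lemma is_arg_atan (x y : R) : 0 < x -> is_arg (atan (y / x)) x y.
Proof.
move=> x0; have c0 : 0 < cos (atan (y / x)).
  by apply: cos_gt0_pihalf; rewrite atan_gtNpi2 atan_ltpi2.
exists (x / cos (atan (y / x))); first exact: divr_gt0.
have := atanK (y / x); rewrite /tan => E; split; first by rewrite divfK ?gt_eqF.
by rewrite -mulrA [_^-1 * _]mulrC E mulrC divfK ?gt_eqF.
Qed.

Lemma is_arg_pihalf : is_arg (pi / 2) 0 1.
Proof. by exists 1; rewrite ?cos_pihalf ?sin_pihalf ?mulr1 ?mulr0. Qed.

Lemma is_arg0 : is_arg 0 1 0.
Proof. by exists 1; rewrite ?cos0 ?sin0 ?mulr1 ?mulr0. Qed.

Lemma atan_itv (x : R) : - (pi / 2) < atan x /\ atan x < pi / 2.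
Proof. by rewrite atan_gtNpi2 atan_ltpi2. Qed.

End Argument.

Section Area.
Variable R : realType.
Implicit Types z w : R[i].

Local Notation Re := complex.Re.
Local Notation Im := complex.Im.

(* The argument of (z - conj w) / i. *)
Definition visual_angle z w : R := atan ((Re w - Re z) / (Im z + Im w)).

Lemma visual_angleC z w : visual_angle w z = - visual_angle z w.
Proof. by rewrite /visual_angle -atanN; congr atan; rewrite [Im w + _]addrC -mulNr opprB. Qed.

Lemma is_arg_visual_angle z w : upper_half_plane z -> upper_half_plane w ->
  is_arg (visual_angle z w) (Im z + Im w) (Re w - Re z).
Proof. by move=> hz hw; apply: is_arg_atan; apply: addr_gt0. Qed.

(* This is the hyperbolic area up to a constant factor. *)
Definition signed_area z1 z2 z3 : R :=
  visual_angle z1 z2 + visual_angle z2 z3 + visual_angle z3 z1.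

Lemma sgr_atan (x : R) : Num.sg (atan x) = Num.sg x.
Proof.
case: (sgrP x) => [->|h|h]; first by rewrite atan0 sgr0.
  by rewrite gtr0_sg // -[ltLHS](@atan0 R) lt_atan.
by rewrite ltr0_sg // -[ltRHS](@atan0 R) lt_atan.
Qed.

(** The signed area is an argument of the product C + i O of the three numbers underlying the visual
    angles. Here C > 0 and O is [orient]; since the area is below 3 pi/2 in absolute value, it
    equals atan (O / C). *)
Lemma sgr_signed_area z1 z2 z3 :
  upper_half_plane z1 -> upper_half_plane z2 -> upper_half_plane z3 ->
  Num.sg (signed_area z1 z2 z3) = Num.sg (orient z1 z2 z3).
Proof.
move=> h1 h2 h3.
have := is_argM (is_argM (is_arg_visual_angle h1 h2) (is_arg_visual_angle h2 h3))
  (is_arg_visual_angle h3 h1).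
move: h1 h2 h3; rewrite /upper_half_plane /orient /=.
have := atan_itv ((Re z2 - Re z1) / (Im z1 + Im z2)).
have := atan_itv ((Re z3 - Re z2) / (Im z2 + Im z3)).
have := atan_itv ((Re z1 - Re z3) / (Im z3 + Im z1)).
rewrite -/(visual_angle z1 z2) -/(visual_angle z2 z3) -/(visual_angle z3 z1).
rewrite -/(signed_area z1 z2 z3).
move=> b3 b2 b1.
have b : `|signed_area z1 z2 z3| < 3 * (pi / 2).
  by rewrite ltr_norml /signed_area; lra.
move: (signed_area z1 z2 z3) b => t b {b1 b2 b3}.
move: (Re z1) (Im z1) (Re z2) (Im z2) (Re z3) (Im z3) => x1 y1 x2 y2 x3 y3.
move=> h1 h2 h3.
set C := (X in is_arg _ X _); set O := (X in is_arg _ _ X) => H.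
have -> : (x2 - x1) * (x3 ^+ 2 + y3 ^+ 2 - (x1 ^+ 2 + y1 ^+ 2)) -
   (x3 - x1) * (x2 ^+ 2 + y2 ^+ 2 - (x1 ^+ 2 + y1 ^+ 2)) = O by rewrite /O; ring.
have C0 : 0 < C.
  pose p := x1 - x2; pose q := x2 - x3.
  have -> : C = (y1 + y2) * (y2 + y3) * (y3 + y1)
    + (p ^+ 2 * y3 + q ^+ 2 * y1 + (p + q) ^+ 2 * y2).
    by rewrite /C /p /q; ring.
  apply: ltr_wpDr; last by rewrite !mulr_gt0 ?addr_gt0.
  by rewrite !addr_ge0 // mulr_ge0 ?sqr_ge0 ?ltW.
have p0 := pi_gt0 R.
have -> : t = atan (O / C).
  apply: is_arg_eq H (is_arg_atan _ C0) _.
  have := atan_itv (O / C); move: b; rewrite !ltr_norml; lra.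
by rewrite sgr_atan sgrM [Num.sg C^-1]gtr0_sg ?invr_gt0 ?mulr1.
Qed.

End Area.

(** * Behaviour of the angles under Moebius maps *)

Section Moebius.
Variable R : realType.
Implicit Types (z w : R[i]) (A B : 'M[R]_2).

Local Notation Re := complex.Re.
Local Notation Im := complex.Im.
Local Notation "x %:C" := (x%:C)%C : ring_scope.

Definition automorphy A z : R[i] := (A 1 0)%:C * z + (A 1 1)%:C.

Definition moebius_mx A z : R[i] := ((A 0 0)%:C * z + (A 0 1)%:C) / automorphy A z.

Lemma detE2 A : \det A = A 0 0 * A 1 1 - A 0 1 * A 1 0.
Proof. by rewrite {1}[A]mx2_eta det2. Qed.

Lemma automorphy_neq0 A z : \det A = 1 -> upper_half_plane z -> automorphy A z != 0.
Proof.
rewrite detE2 /automorphy; case: z => x y D; rewrite /upper_half_plane /= => y0.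
rewrite eq_complex /= !mul0r subr0 !addr0 mulf_eq0 (gt_eqF y0) orbF.
apply/negP => /andP[/eqP d0 /eqP c0]; move: D; rewrite c0 mul0r add0r in d0 *.
by rewrite d0 !mulr0 subrr => /esym/eqP; rewrite oner_eq0.
Qed.

Lemma moebius_mx_eq A z w : \det A = 1 -> upper_half_plane z ->
  (A 0 0)%:C * z + (A 0 1)%:C = w * automorphy A z -> moebius_mx A z = w.
Proof. by move=> D hz E; rewrite /moebius_mx E mulfK ?automorphy_neq0. Qed.

(* automorphy A z / c *)
Definition pole_distance A z : R[i] := Complex (Re z + A 1 1 / A 1 0) (Im z).

Lemma pole_distance_gt0 A z : upper_half_plane z ->
  0 < Re (pole_distance A z) ^+ 2 + Im (pole_distance A z) ^+ 2.
Proof.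
move=> hz; apply: ltr_wpDl; first exact: sqr_ge0.
by rewrite exprn_gt0.
Qed.

(** This is g z = a/c - 1/(c^2 u) with u = z + d/c, where n = |c z + d|^2. *)
Lemma moebius_mxE A z : \det A = 1 -> upper_half_plane z -> A 1 0 != 0 ->
  let u := pole_distance A z in
  let n := A 1 0 ^+ 2 * (Re u ^+ 2 + Im u ^+ 2) in
  moebius_mx A z = Complex (A 0 0 / A 1 0 - Re u / n) (Im u / n).
Proof.
move=> D hz c0 u n; apply: moebius_mx_eq => //.
have := pole_distance_gt0 A hz; rewrite -/u => n0.
have nE : n = A 1 0 ^+ 2 * (Re u ^+ 2 + Im u ^+ 2) by [].
have n0' : n != 0 by rewrite mulf_neq0 ?expf_neq0 // gt_eqF.
clearbody n; move: D n0 nE; rewrite detE2 /automorphy /u /= {u}.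
case: z hz => x y; rewrite /upper_half_plane /= => y0.
move: (A 0 0) (A 0 1) (A 1 0) (A 1 1) c0 => a b c d c0 D n0 nE.
have bE : b = (a * d - 1) / c by rewrite -D; field.
apply/eqP; rewrite eq_complex /=; apply/andP; split; apply/eqP.
  transitivity (a / c * (c * x + d) - n / n / c); first by rewrite bE; field; rewrite c0 n0'.
  by rewrite {1}nE; field; rewrite c0 n0'.
transitivity (a * y); first by ring.
transitivity (a * y - (x + d / c) / n * (c * y) + y / n * (c * x + d)); last by field; rewrite c0 n0'.
by field; rewrite c0 n0'.
Qed.

Lemma moebius_mxE0 A z : \det A = 1 -> upper_half_plane z -> A 1 0 = 0 ->
  moebius_mx A z = Complex ((A 0 0 * Re z + A 0 1) / A 1 1) (A 0 0 * Im z / A 1 1).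
Proof.
move=> D hz c0; apply: moebius_mx_eq => //; move: D; rewrite detE2 c0 mulr0 subr0 => D.
have d0 : A 1 1 != 0 by apply/eqP => d0; move: D; rewrite d0 mulr0 => /esym/eqP; rewrite oner_eq0.
rewrite /automorphy c0; case: z hz => x y; rewrite /upper_half_plane /= => y0.
by apply/eqP; rewrite eq_complex /=; apply/andP; split; apply/eqP; field; rewrite d0.
Qed.

Lemma moebius_mx_upper A z : \det A = 1 -> upper_half_plane z ->
  upper_half_plane (moebius_mx A z).
Proof.
move=> D hz; have [c0|c0] := eqVneq (A 1 0) 0.
  rewrite moebius_mxE0 // /upper_half_plane /=.
  have ad : A 0 0 * A 1 1 = 1 by rewrite -D detE2 c0 mulr0 subr0.
  have d0 : A 1 1 != 0 by apply/eqP => d0; move: ad; rewrite d0 mulr0 => /esym/eqP; rewrite oner_eq0.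
  have -> : A 0 0 * Im z / A 1 1 = Im z / A 1 1 ^+ 2 by rewrite -[RHS]mul1r -[in RHS]ad; field.
  by rewrite divr_gt0 // exprn_even_gt0.
rewrite moebius_mxE // /upper_half_plane /= divr_gt0 // mulr_gt0 ?exprn_even_gt0 //.
exact: (pole_distance_gt0 A hz).
Qed.

Lemma automorphyM A B z : \det B = 1 -> upper_half_plane z ->
  automorphy (A *m B) z = automorphy A (moebius_mx B z) * automorphy B z.
Proof.
move=> D hz; have j0 := automorphy_neq0 D hz.
rewrite {1}/automorphy {1}/automorphy mulrDl /moebius_mx mulrA divfK //.
by rewrite !mulmx2E /automorphy !(rmorphD, rmorphM); ring.
Qed.

Lemma moebius_mxM A B z : \det A = 1 -> \det B = 1 -> upper_half_plane z ->
  moebius_mx (A *m B) z = moebius_mx A (moebius_mx B z).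
Proof.
move=> DA DB hz; apply: moebius_mx_eq => //; first by rewrite det_mulmx DA DB mulr1.
rewrite automorphyM // mulrA /moebius_mx divfK.
  rewrite mulrDl mulrA divfK ?automorphy_neq0 // /automorphy !mulmx2E.
  by rewrite !(rmorphD, rmorphM); ring.
by apply: automorphy_neq0 => //; apply: moebius_mx_upper.
Qed.

Lemma moebius_mxN A z : moebius_mx (- A) z = moebius_mx A z.
Proof.
rewrite /moebius_mx /automorphy !mxE !rmorphN /= !mulNr -!opprD invrN mulrNN //.
Qed.

(* The argument of i * conj (automorphy A z) / c, which does not depend on    *)
(* the sign of A; set to 0 for c = 0.                                         *)
Definition pole_angle A z : R :=
  if A 1 0 == 0 then 0 else atan (Re (pole_distance A z) / Im z).

Lemma is_arg_pole_angle A z : upper_half_plane z -> A 1 0 != 0 ->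
  is_arg (pole_angle A z) (Im (pole_distance A z)) (Re (pole_distance A z)).
Proof. by move=> hz c0; rewrite /pole_angle (negPf c0); apply: is_arg_atan. Qed.

Lemma pole_angle_itv A z : - (pi / 2) < pole_angle A z /\ pole_angle A z < pi / 2.
Proof.
rewrite /pole_angle; case: eqP => _; last exact: atan_itv.
by have := pi_gt0 R; lra.
Qed.

Lemma pole_angleN A z : pole_angle (- A) z = pole_angle A z.
Proof. by rewrite /pole_angle /pole_distance !mxE oppr_eq0 invrN mulrNN. Qed.

(** Compare arguments in gz - conj(gw) = (z - conj w) / (j(z) conj(j(w))), where j(z) = c z + d; the
    two sides involve four angles below pi/2, hence differ by less than 2 pi. *)
Lemma visual_angle_moebius A z w : \det A = 1 ->
  upper_half_plane z -> upper_half_plane w ->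
  visual_angle (moebius_mx A z) (moebius_mx A w) =
  visual_angle z w + pole_angle A z - pole_angle A w.
Proof.
move=> D hz hw; have hgz := moebius_mx_upper D hz; have hgw := moebius_mx_upper D hw.
have [c0|c0] := eqVneq (A 1 0) 0.
  rewrite /pole_angle c0 eqxx addr0 subr0 /visual_angle !moebius_mxE0 //=.
  have ad : A 0 0 * A 1 1 = 1 by rewrite -D detE2 c0 mulr0 subr0.
  have d0 : A 1 1 != 0 by apply/eqP => d0; move: ad; rewrite d0 mulr0 => /esym/eqP; rewrite oner_eq0.
  have a0 : A 0 0 != 0 by apply/eqP => a0; move: ad; rewrite a0 mul0r => /esym/eqP; rewrite oner_eq0.
  have y0 : Im z + Im w != 0 by rewrite gt_eqF // addr_gt0.
  by congr atan; field; rewrite -mulrDr y0 d0 mulf_neq0.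
apply: (is_arg_eq (is_arg_visual_angle hgz hgw)).
  have H := is_argM (is_argM (is_arg_visual_angle hz hw) (is_arg_pole_angle hz c0))
    (is_argN (is_arg_pole_angle hw c0)).
  have nz := pole_distance_gt0 A hz; have nw := pole_distance_gt0 A hw.
  set n := Re (pole_distance A z) ^+ 2 + _ in nz.
  set m := Re (pole_distance A w) ^+ 2 + _ in nw.
  apply: (@is_argZ _ _ _ _ (A 1 0 ^+ 2 * n * m)).
    by do 2![apply: mulr_gt0 => //]; rewrite exprn_even_gt0.
  rewrite !moebius_mxE //= -/n -/m.
  have n0 : n != 0 by rewrite gt_eqF.
  have m0 : m != 0 by rewrite gt_eqF.
  move: H; set X := (X in is_arg _ X _); set Y := (X in is_arg _ _ X).
  have nE : n = (Re z + A 1 1 / A 1 0) ^+ 2 + Im z ^+ 2 by [].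
  have mE : m = (Re w + A 1 1 / A 1 0) ^+ 2 + Im w ^+ 2 by [].
  set X' := (X in _ -> is_arg _ X _); set Y' := (X in _ -> is_arg _ _ X).
  have -> : X' = Im z * m + Im w * n by rewrite /X'; field; rewrite c0 n0 m0.
  have -> : Y' = (Re z + A 1 1 / A 1 0) * m - (Re w + A 1 1 / A 1 0) * n.
    by rewrite /Y'; field; rewrite c0 n0 m0.
  have -> : X = Im z * m + Im w * n by rewrite /X /= nE mE; ring.
  by have -> : Y = (Re z + A 1 1 / A 1 0) * m - (Re w + A 1 1 / A 1 0) * n
    by rewrite /Y /= nE mE; ring.
have [h1 h2] := atan_itv ((Re w - Re z) / (Im z + Im w)).
have [h3 h4] := atan_itv ((Re (moebius_mx A w) - Re (moebius_mx A z))
  / (Im (moebius_mx A z) + Im (moebius_mx A w))).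
have [h5 h6] := pole_angle_itv A z; have [h7 h8] := pole_angle_itv A w.
by rewrite ltr_norml /visual_angle; lra.
Qed.


(** Take arguments in the chain rule for c z + d. Dividing each factor by its own c leaves the real
    number k = c_AB / (c_A c_B), and the normalizing factors i leave one extra i. Together they
    rotate by pi/2 times the sign of k, which is the sign cochain. *)
Lemma pole_angle_cocycle A B z : \det A = 1 -> \det B = 1 -> upper_half_plane z ->
  pole_angle A (moebius_mx B z) + pole_angle B z =
  pole_angle (A *m B) z + pi / 2 * sign_cochain A B.
Proof.
move=> DA DB hz; have hw := moebius_mx_upper DB hz.
have DAB : \det (A *m B) = 1 by rewrite det_mulmx DA DB mulr1.
have cE : (A *m B) 1 0 = A 1 0 * B 0 0 + A 1 1 * B 1 0 by rewrite mulmx2E.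
have dE : (A *m B) 1 1 = A 1 0 * B 0 1 + A 1 1 * B 1 1 by rewrite mulmx2E.
have y0 : Im z != 0 by rewrite gt_eqF.
have [cA|cA] := eqVneq (A 1 0) 0.
  rewrite /sign_cochain cA !mul0r sgr0 mulr0 addr0 {1}/pole_angle cA eqxx add0r.
  have d0 : A 1 1 != 0.
    by apply: contra_eq_neq DA => d0; rewrite detE2 d0 cA !mulr0 subrr eq_sym oner_eq0.
  rewrite /pole_angle /pole_distance cE dE cA !mul0r !add0r mulf_eq0 (negPf d0) /=.
  case: eqP => // /eqP cB; congr (atan ((_ + _) / _)).
  by field; rewrite cB d0.
have [cB|cB] := eqVneq (B 1 0) 0.
  rewrite /sign_cochain cB mulr0 mul0r sgr0 mulr0 addr0 [pole_angle B _]/pole_angle cB eqxx addr0.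
  have ad : B 0 0 * B 1 1 = 1 by rewrite -DB detE2 cB mulr0 subr0.
  have [a0 d0] : B 0 0 != 0 /\ B 1 1 != 0.
    by apply/andP; rewrite -negb_or -mulf_eq0 ad oner_eq0.
  rewrite /pole_angle cE cB mulr0 addr0 mulf_eq0 (negPf cA) (negPf a0) /=.
  congr atan; rewrite moebius_mxE0 // /pole_distance cE dE cB mulr0 addr0 /=.
  by field; rewrite cA a0 d0 y0.
have HA := is_arg_pole_angle hw cA; have HB := is_arg_pole_angle hz cB.
have H := is_argM HA HB.
have [b1 b2] := pole_angle_itv A (moebius_mx B z).
have [b3 b4] := pole_angle_itv B z; have [b5 b6] := pole_angle_itv (A *m B) z.
have p0 := pi_gt0 R.
have nB := pole_distance_gt0 B hz; set n := Re _ ^+ 2 + _ in nB.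
have nE : n = (Re z + B 1 1 / B 1 0) ^+ 2 + Im z ^+ 2 by [].
have n0 : n != 0 by rewrite gt_eqF.
pose k := (A *m B) 1 0 / (A 1 0 * B 1 0).
have kE : k = B 0 0 / B 1 0 + A 1 1 / A 1 0 by rewrite /k cE; field; rewrite cA cB.
have {}H : is_arg (pole_angle A (moebius_mx B z) + pole_angle B z)
    ((B 1 0 ^+ 2)^-1 - k * (Re z + B 1 1 / B 1 0)) (k * Im z).
  move: H; rewrite /pole_distance moebius_mxE //= -/n kE.
  set X := (X in is_arg _ X _ -> _); set Y := (X in is_arg _ _ X -> _).
  set X' := (X in _ -> is_arg _ X _); set Y' := (X in _ -> is_arg _ _ X).
  have -> : X = X'.
    transitivity (n / n / B 1 0 ^+ 2 - (B 0 0 / B 1 0 + A 1 1 / A 1 0) * (Re z + B 1 1 / B 1 0)).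
      by rewrite {1}nE /X; field; rewrite cA cB n0.
    by rewrite divff // mul1r.
  by have -> : Y = Y' by rewrite /Y /Y'; field; rewrite cA cB n0.
have sE : sign_cochain A B = Num.sg k.
  rewrite /sign_cochain /k [RHS]sgrM sgrV -sgrM mulrC.
  by rewrite [(A *m B) 1 0 * _]mulrC.
rewrite sE.
have key : k != 0 -> (B 1 0 ^+ 2)^-1 - k * (Re z + B 1 1 / B 1 0) =
    - (k * Re (pole_distance (A *m B) z)).
  rewrite mulf_eq0 negb_or => /andP[cAB _].
  have : (A *m B) 1 1 * B 1 0 - (A *m B) 1 0 * B 1 1 = - A 1 0.
    by rewrite cE dE -[RHS]mulr1 -[in RHS]DB detE2; ring.
  move=> E; have -> : (B 1 0 ^+ 2)^-1 = - (- A 1 0) / (A 1 0 * B 1 0 ^+ 2).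
    by field; rewrite cA cB.
  by rewrite -E /k /=; field; rewrite cA cB cAB.
case: (sgrP k) H key => [k0|k0|k0] H key.
- rewrite mulr0 addr0 [RHS]/pole_angle ifT.
    apply: is_arg_eq (is_arg0 R) _; last by rewrite subr0 ltr_norml; lra.
    have c20 : 0 < (B 1 0 ^+ 2)^-1 by rewrite invr_gt0 exprn_even_gt0.
    by apply: (is_argZ c20); move: H; rewrite k0 !mul0r subr0 mulr1 mulr0.
  by move/eqP: k0; rewrite mulf_eq0 invr_eq0 mulf_eq0 (negPf cA) (negPf cB) !orbF.
- have kn : k != 0 by rewrite gt_eqF.
  have cAB : (A *m B) 1 0 != 0 by move: kn; rewrite mulf_eq0 negb_or => /andP[].
  rewrite mulr1; have := is_argM (is_arg_pole_angle hz cAB) (@is_arg_pihalf R).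
  rewrite !mulr0 !mulr1 sub0r addr0 => H2; apply: (is_arg_eq _ H2).
    by apply: (is_argZ k0); rewrite mulrN -key //=.
  by rewrite ltr_norml; lra.
have kn : k != 0 by rewrite lt_eqF.
have cAB : (A *m B) 1 0 != 0 by move: kn; rewrite mulf_eq0 negb_or => /andP[].
rewrite mulrN1; have := is_argM (is_arg_pole_angle hz cAB) (is_argN (@is_arg_pihalf R)).
rewrite !mulr0 !mulrN !mulr1 sub0r addr0 opprK => H2; apply: (is_arg_eq _ H2).
  by apply: (@is_argZ _ _ _ _ (- k)); rewrite ?oppr_gt0 // mulrN !mulNr opprK -key //=.
by rewrite ltr_norml; lra.
Qed.

Lemma moebius_mx_repr (p : PSL2 R) z : moebius p z = moebius_mx (repr p) z.
Proof. by []. Qed.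

Lemma repr_PSL2_mul_sign (p q : PSL2 R) :
  (repr (p * q)%g : 'M[R]_2) = repr p *m repr q \/
  (repr (p * q)%g : 'M[R]_2) = - (repr p *m repr q).
Proof.
by have [s [->|->] ->] := repr_PSL2_mul p q; rewrite ?scale1r ?scaleN1r; [left|right].
Qed.

Lemma moebiusM (p q : PSL2 R) z : upper_half_plane z ->
  moebius (p * q)%g z = moebius p (moebius q z).
Proof.
move=> hz; rewrite !moebius_mx_repr -moebius_mxM ?det_repr //.
by have [->|->] := repr_PSL2_mul_sign p q; rewrite ?moebius_mxN.
Qed.

(** The side from p z to pq z is the image under p of the side from z to q z, so its visual angle
    changes by pole angles. The defect of additivity of these is the sign cochain. *)
Lemma sign_cochain_area z : upper_half_plane z ->
  let v (p : PSL2 R) := visual_angle z (moebius p z) + pole_angle (repr p) z in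
  forall p q : PSL2 R,
  signed_area z (moebius p z) (moebius (p * q)%g z) =
  coboundary1 v p q - pi / 2 * sign_cochain (repr p : 'M[R]_2) (repr q).
Proof.
move=> hz v p q; rewrite /signed_area moebiusM //.
have hq := moebius_mx_upper (det_repr q) hz.
rewrite visual_angle_moebius ?det_repr // -moebiusM // [X in _ + X]visual_angleC.
have := pole_angle_cocycle (det_repr p) (det_repr q) hz.
have -> : pole_angle (repr p *m repr q) z = pole_angle (repr (p * q)%g) z.
  by have [->|->] := repr_PSL2_mul_sign p q; rewrite ?pole_angleN.
rewrite /coboundary1 /v -!moebius_mx_repr; lra.
Qed.

End Moebius.

(** * Comparison with the Euler class *)

(** Expanding w on the finitely many group elements that occur makes each of its values multiply a
    boundary coefficient of the cycle, which is 0. *)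
Lemma sum_coboundary_cycle (G : groupType) (V : comPzRingType) (sgn : G * G -> int)
    (c : seq (G * G)) (w : G -> V) :
  (forall k : G, \sum_(s <- c) sgn s *
     ((s.2 == k)%:R - ((s.1 * s.2)%g == k)%:R + (s.1 == k)%:R) = 0) ->
  \sum_(s <- c) (sgn s)%:~R * coboundary1 w s.1 s.2 = 0.
Proof.
move=> cyc.
pose K := undup ([seq s.2 | s <- c] ++ [seq (s.1 * s.2)%g | s <- c] ++ [seq s.1 | s <- c]).
have pick (x : G) : x \in K -> w x = \sum_(k <- K) w k * (x == k)%:R.
  move=> xK; rewrite (bigD1_seq x) ?undup_uniq //= eqxx mulr1 big1 ?addr0 // => k kx.
  by rewrite eq_sym (negPf kx) mulr0.
transitivity (\sum_(s <- c) \sum_(k <- K) w k * (sgn s *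
     ((s.2 == k)%:R - ((s.1 * s.2)%g == k)%:R + (s.1 == k)%:R))%:~R).
  rewrite !big_seq; apply: eq_bigr => s sc; rewrite /coboundary1.
  rewrite (pick s.2) ?(pick (s.1 * s.2)%g) ?(pick s.1); last first.
  - by rewrite mem_undup !mem_cat (map_f (fun s => s.2)) ?orbT.
  - by rewrite mem_undup !mem_cat (map_f (fun s => (s.1 * s.2)%g)) ?orbT.
  - by rewrite mem_undup !mem_cat (map_f (fun s => s.1)) ?orbT.
  rewrite -sumrB -big_split mulr_sumr; apply: eq_bigr => k _.
  rewrite intrM [RHS]mulrCA; congr (_ * _).
  by rewrite intrD intrB !natz -!pmulrn !mulrDr mulrN.
rewrite exchange_big big1 // => k _; rewrite -mulr_sumr.
by rewrite -rmorph_sum cyc mulr0.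
Qed.

(** pi E differs from the signed area by a coboundary, which a cycle does not see. Each
    [simplex_sign] is the sign of the corresponding area, so the evaluation times pi is the sum of
    the absolute areas. *)
Lemma evaluation_gt0 (R : realType) (E : PSL2 R -> PSL2 R -> int)
    (Gamma : set (PSL2 R)) (x : R[i]) (c : seq (PSL2 R * PSL2 R)) :
  universal_cover_cocycle E -> upper_half_plane x ->
  fundamental_cycle Gamma x c -> (0 < size c)%N -> 0 < evaluation E x c.
Proof.
move=> /universal_cover_sign[nu nuE] hx [simp _ _ cyc] c0.
have p0 := pi_gt0 R.
pose v (p : PSL2 R) := visual_angle x (moebius p x) + pole_angle (repr p) x.
pose w (p : PSL2 R) : R := pi / 2 * (nu p)%:~R - v p.
have EE p q : pi * (E p q)%:~R =
    signed_area x (moebius p x) (moebius (p * q)%g x) + coboundary1 w p q.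
  have := nuE p q; rewrite sign_cochain_area // -/v intrM => H.
  have -> : pi * (E p q)%:~R = pi / 2 * (2%:~R * (E p q)%:~R) :> R by field.
  by rewrite H /coboundary1 /w intrD intrB; ring.
rewrite -(ltr0z R) -(pmulr_rgt0 _ p0) /evaluation rmorph_sum mulr_sumr.
have -> : \sum_(s <- c) pi * (simplex_sign x s * E s.1 s.2)%:~R =
  \sum_(s <- c) `|signed_area x (moebius s.1 x) (moebius (s.1 * s.2)%g x)|.
  transitivity (\sum_(s <- c) ((simplex_sign x s)%:~R * signed_area x (moebius s.1 x) (moebius (s.1 * s.2)%g x)
     + (simplex_sign x s)%:~R * coboundary1 w s.1 s.2)).
    by apply: eq_bigr => s _; rewrite intrM mulrCA EE mulrDr.
  rewrite big_split /= sum_coboundary_cycle // addr0; apply: eq_bigr => s _.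
  rewrite /simplex_sign -sgrEz -sgr_signed_area ?mulr_sg_norm //; last 2 first.
  - exact: moebius_mx_upper (det_repr _) hx.
  - exact: moebius_mx_upper (det_repr _) hx.
  by rewrite normrEsg.
case: c c0 simp {cyc} => // s c _ simp; rewrite big_cons.
apply: ltr_wpDr; first by apply: sumr_ge0.
have [_ _ sx] := simp s (mem_head _ _).
rewrite normr_gt0 -sgr_eq0 sgr_signed_area.
- by rewrite sgr_eq0 -sgz_eq0.
- done.
- exact: moebius_mx_upper (det_repr _) hx.
- exact: moebius_mx_upper (det_repr _) hx.
Qed.

(** With eps = 1 the negative number 2 - 2g would be a positive evaluation. *)
Lemma euler_cocycle_opp (R : realType) (E : PSL2 R -> PSL2 R -> int) :
  euler_cocycle E ->
  exists2 E0, universal_cover_cocycle E0 & forall p q, E p q = - E0 p q.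
Proof.
move=> [eps [E0 [eps1 cE0 EE [Gamma [x [c [g [_ hx fc [cg g2] ev]]]]]]]].
exists E0 => // p q; rewrite EE.
case: eps1 EE => [->|->] EE; last by rewrite mulN1r.
have c0 : (0 < size c)%N by rewrite lt0n; apply: contraTneq g2 => c0; move: cg; rewrite /has_genus c0; lia.
have := evaluation_gt0 cE0 hx fc c0.
have -> : evaluation E0 x c = evaluation E x c.
  by apply: eq_bigr => s _; rewrite EE mul1r.
by rewrite ev; move: g2; lia.
Qed.

Section Restriction.
Variable R : realType.

Lemma repr_PSL2_ratr (p : PSL2 rat) :
  exists2 s : R, s = 1 \/ s = -1 &
    (repr (PSL2_ratr R p) : 'M[R]_2) = s *: map_mx ratr (repr p : 'M[rat]_2).
Proof.
have [->|->] := PSL2_reprP (SL2_ratr R (repr p)).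
  by exists 1; [left|rewrite scale1r].
by exists (-1); [right|rewrite scaleN1r].
Qed.

Lemma PSL2_ratrM (p q : PSL2 rat) :
  PSL2_ratr R (p * q)%g = (PSL2_ratr R p * PSL2_ratr R q)%g.
Proof.
rewrite /PSL2_ratr [RHS]PSL2_mul_pi; apply/eqP/PSL2_eqP.
have [E|E] := PSL2_reprP (repr p * repr q)%g; [left; apply/val_inj|right].
  by rewrite /= -map_mxM; congr map_mx; rewrite -[RHS]/(mx_of_SL2 (repr p * repr q)%g) -E.
rewrite /= -map_mxM -map_mxN; congr map_mx; exact: E.
Qed.

Lemma sign_cochain_ratr (p q : PSL2 rat) :
  sign_cochain (repr (PSL2_ratr R p) : 'M[R]_2) (repr (PSL2_ratr R q)) =
  ratr (sign_cochain (repr p : 'M[rat]_2) (repr q)).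
Proof.
have [s s1 ->] := repr_PSL2_ratr p; have [t t1 ->] := repr_PSL2_ratr q.
rewrite (sign_cochain_sign _ _ s1).1 (sign_cochain_sign _ _ t1).2.
by rewrite /sign_cochain -map_mxM !mxE ratr_sg !rmorphM.
Qed.

End Restriction.

Theorem theorem17 (R : realType) :
  exists r : PSL2 rat -> PSL2 rat -> rat,
    [/\ forall (p q : PSL2 rat) (M1 M2 : 'M[int]_2),
          integral_representative M1 p -> integral_representative M2 q ->
          0 <= M2 1 0 -> r p q = rho M1 M2,
        cocycle2 r &
        forall E : PSL2 R -> PSL2 R -> int, euler_cocycle E ->
          cohomologous r (restrict_to_PSL2Q E)].
Proof.
exists rho_cochain; split; [exact: rho_cochainE|exact: rho_cochain_cocycle|].
move=> E /euler_cocycle_opp[E0 /universal_cover_sign[nu nuE] EE].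
(* The first term removes -2 du from rho, the second removes d nu from 2 E0; the two sign terms then
   cancel because the Euler cocycle is -E0. *)
exists (fun p : PSL2 rat =>
  - 2 * rademacher_mx (repr p) + (nu (PSL2_ratr R p))%:~R / 2) => p q.
rewrite /restrict_to_PSL2Q EE.
have : ((2 * E0 (PSL2_ratr R p) (PSL2_ratr R q))%:~R : rat) =
    (coboundary1 nu (PSL2_ratr R p) (PSL2_ratr R q))%:~R
    - sign_cochain (repr p : 'M[rat]_2) (repr q).
  (* [universal_cover_sign] is an identity between real numbers; it descends along the injection of
     the rationals, which preserves signs. *)
  apply: (fmorph_inj (ratr : rat -> R)).
  by rewrite rmorphB /= !ratr_int nuE sign_cochain_ratr.
rewrite /rho_cochain /coboundary1 PSL2_ratrM intrM intrN !(intrD, intrN).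
move: (sign_cochain _ _) (E0 _ _)%:~R => S e.
do 3![move: (rademacher_mx _) => ?]; do 3![move: (nu _)%:~R => ?].
lra.
Qed.
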